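(* In the semilinear setting described in the context, with $\mathcal{A}=A+F$, assume that: (i) $C$ is $A$-bounded, i.e. there exist positive constants $a,b$ such that $\|Cw\|_Z\leq a\|Aw\|_H+b\|w\|_H$ for all $w\in\mathcal{D}(A)$; (ii) there exists $\alpha>0$ such that $(Ah+\mathrm{d}F(w)h,h)_H\geq\alpha\|h\|_H^2$ for all $w\in H$ and all $h\in\mathcal{D}(A)$. Then there exists a map $\mathcal{M}\in\mathcal{C}^1(H,Z)$, with $\mathrm{d}\mathcal{M}$ locally Lipschitz continuous, satisfying $$\mathcal{M}(0)=0,\qquad \mathrm{d}\mathcal{M}(w)\mathcal{A}(w)+Cw=0\quad\text{for all } w\in\mathcal{D}(\mathcal{A})=\mathcal{D}(A),$$ and given for all $w\in H$ by $$\mathcal{M}(w)=-C\left\{\lim_{\tau\to+\infty}\int_0^\tau\mathcal{T}_tw\,\mathrm{d}t\right\}=-CA^{-1}w+CA^{-1}\int_0^{+\infty}F(\mathcal{T}_tw)\,\mathrm{d}t.$$ For all $w,h\in H$, $$\mathrm{d}\mathcal{M}(w)h=-CA^{-1}h+CA^{-1}\int_0^{+\infty}\mathrm{d}F(\mathcal{T}_tw)\,\mathrm{d}\mathcal{T}_t(w)h\,\mathrm{d}t,$$ where $\mathrm{d}\mathcal{T}_t(w)$ denotes the (Fréchet) differential of $\mathcal{T}_t$ at $w$, which exists. Moreover, if $F$ and $\mathrm{d}F$ are globally Lipschitz continuous, then so is $\mathrm{d}\mathcal{M}$.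
   Context: $H$ and $Z$ are real Hilbert spaces. $-A$ is the infinitesimal generator of a strongly continuous semigroup $\{\mathcal{S}_t\}$ of linear operators on $H$, with domain $\mathcal{D}(A)$. $F\in\mathcal{C}^1(H,H)$ is a nonlinear map with $\mathrm{d}F:H\to\mathcal{L}(H)$ locally Lipschitz continuous, $F(0)=0$ and $\mathrm{d}F(0)=0$. The nonlinear operator $\mathcal{A}=A+F$ has domain $\mathcal{D}(\mathcal{A})=\mathcal{D}(A)$. $C:\mathcal{D}(C)\to Z$ is a (possibly unbounded) linear map defined on a dense subspace $\mathcal{D}(C)\supset\mathcal{D}(A)$ of $H$. Under assumption (ii), $0$ is in the resolvent set of $A$ (so $A^{-1}\in\mathcal{L}(H)$), $\mathcal{A}$ is maximal monotone and satisfies $(\mathcal{A}(w_1)-\mathcal{A}(w_2),w_1-w_2)_H\geq\alpha\|w_1-w_2\|_H^2$ on $\mathcal{D}(\mathcal{A})$, and $-\mathcal{A}$ generates a strongly continuous semigroup of (nonlinear) contractions $\{\mathcal{T}_t\}$ on $H$: $t\mapsto\mathcal{T}_tw_0$ is the unique continuous solution of $\mathcal{T}_tw_0=\mathcal{S}_tw_0-\int_0^t\mathcal{S}_{t-s}F(\mathcal{T}_sw_0)\,\mathrm{d}s$, $t\geq0$. A map is called locally Lipschitz continuous if it is Lipschitz continuous on every bounded set. $\mathcal{C}^1$ means continuously Fréchet differentiable; differentials are measured in operator norm. The limit as $\tau\to+\infty$ is taken in $H$. *)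

(* Defs.v *)
From Stdlib Require Export Reals.
From Coquelicot Require Export Coquelicot.
Open Scope R_scope.

(** Real Hilbert spaces *)

Record Hilbert := {
  hilbert_space :> CompleteNormedModule R_AbsRing;
  inner : hilbert_space -> hilbert_space -> R;
  inner_sym : forall x y, inner x y = inner y x;
  inner_plus_l : forall x y z, inner (plus x y) z = inner x z + inner y z;
  inner_scal_l : forall (k : R) x y, inner (scal k x) y = k * inner x y;
  inner_norm : forall x, inner x x = norm x ^ 2
}.

Arguments inner {h} x y.

(** Linear operators that need not be bounded or everywhere defined.
    The values of [op] outside [dom] carry no meaning. *)

Record linear_operator (U V : NormedModule R_AbsRing) := {
  dom : U -> Prop;
  op :> U -> V;
  dom_zero : dom zero;
  dom_plus : forall x y, dom x -> dom y -> dom (plus x y);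
  dom_scal : forall (k : R) x, dom x -> dom (scal k x);
  op_plus : forall x y, dom x -> dom y -> op (plus x y) = plus (op x) (op y);
  op_scal : forall (k : R) x, dom x -> op (scal k x) = scal k (op x)
}.

Arguments dom {U V} l x.
Arguments op {U V} l x.

Definition dense {U : NormedModule R_AbsRing} (D : U -> Prop) : Prop :=
  forall (x : U) (eps : posreal), exists y, ball x eps y /\ D y.

(* [0] is in the resolvent set of [A], with [A^-1 = Ainv] in L(H);
   [is_linear] includes boundedness. *)
Definition is_bounded_inverse {U : NormedModule R_AbsRing}
    (A : linear_operator U U) (Ainv : U -> U) : Prop :=
  is_linear Ainv /\
  (forall x, dom A (Ainv x) /\ A (Ainv x) = x) /\
  (forall x, dom A x -> Ainv (A x) = x).

(** Strongly continuous semigroups; values at negative times are irrelevant. *)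

Definition is_C0_semigroup {U : NormedModule R_AbsRing} (S : R -> U -> U)
    : Prop :=
  (forall t, 0 <= t -> is_linear (S t)) /\
  (forall x, S 0 x = x) /\
  (forall s t x, 0 <= s -> 0 <= t -> S (s + t) x = S s (S t x)) /\
  (forall x, filterlim (fun t => S t x) (at_right 0) (locally x)).

(* [-A], with domain exactly [dom A], is the infinitesimal generator of [S]. *)
Definition opp_is_generator {U : NormedModule R_AbsRing} (S : R -> U -> U)
    (A : linear_operator U U) : Prop :=
  forall x y : U,
    dom A x /\ opp (A x) = y <->
    filterlim (fun t => scal (/ t) (minus (S t x) x)) (at_right 0) (locally y).

(* [u] is a continuous solution on [0,+oo) of
   u(t) = S_t w0 - int_0^t S_(t-s) F(u(s)) ds. *)
Definition is_mild_solution {U : NormedModule R_AbsRing} (S : R -> U -> U)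
    (F : U -> U) (w0 : U) (u : R -> U) : Prop :=
  continuous_on (fun t => 0 <= t) u /\
  forall t, 0 <= t ->
    exists I, is_RInt (fun s => S (t - s) (F (u s))) 0 t I /\
              u t = minus (S t w0) I.

(** Operator norm, as a supremum in [Rbar]: [p_infty] if [f] is unbounded *)

Definition op_norm {U V : NormedModule R_AbsRing} (f : U -> V) : Rbar :=
  Lub_Rbar (fun r => exists h, norm h <= 1 /\ r = norm (f h)).

(** Differentials: [df w] is the Frechet differential of [f] at [w] *)

Definition is_C1 {U V : NormedModule R_AbsRing} (f : U -> V)
    (df : U -> U -> V) : Prop :=
  (forall w, filterdiff f (locally w) (df w)) /\
  (forall w (eps : posreal),
     locally w (fun v =>
       Rbar_lt (op_norm (fun h => minus (df v h) (df w h))) eps)).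

Definition bounded_set {U : NormedModule R_AbsRing} (B : U -> Prop) : Prop :=
  exists r, forall x, B x -> norm x <= r.

Definition lipschitz_on {U V : NormedModule R_AbsRing} (B : U -> Prop)
    (f : U -> V) : Prop :=
  exists L : R, 0 <= L /\
    forall x y, B x -> B y ->
      norm (minus (f x) (f y)) <= L * norm (minus x y).

Definition globally_lipschitz {U V : NormedModule R_AbsRing} (f : U -> V)
    : Prop :=
  lipschitz_on (fun _ => True) f.

(* The same notions for maps into bounded linear operators. *)
Definition op_lipschitz_on {U V W : NormedModule R_AbsRing} (B : U -> Prop)
    (df : U -> V -> W) : Prop :=
  exists L : R, 0 <= L /\
    forall x y, B x -> B y ->
      Rbar_le (op_norm (fun h => minus (df x h) (df y h)))
              (L * norm (minus x y)).

Definition op_locally_lipschitz {U V W : NormedModule R_AbsRing}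
    (df : U -> V -> W) : Prop :=
  forall B, bounded_set B -> op_lipschitz_on B df.

Definition op_globally_lipschitz {U V W : NormedModule R_AbsRing}
    (df : U -> V -> W) : Prop :=
  op_lipschitz_on (fun _ => True) df.

(** Integrals over [0,+oo) *)

(* [l] is the limit in [V] of [int_0^tau f(t) dt] as [tau] tends to [+oo]. *)
Definition is_lim_integral {V : NormedModule R_AbsRing} (f : R -> V) (l : V)
    : Prop :=
  is_RInt_gen f (at_point 0) (Rbar_locally p_infty) l.

(* Absolutely convergent integral. *)
Definition is_integral_0_infty {V : NormedModule R_AbsRing} (f : R -> V)
    (l : V) : Prop :=
  is_lim_integral f l /\
  exists n : R, is_lim_integral (V := R_NormedModule) (fun t => norm (f t)) n.

(* Main.v *)
Require Import Defs.
From Stdlib Require Import Lra Psatz Lia Classical IndefiniteDescription.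

(** Write [A + F] for the operator of the statement and [K = C A^-1], which is
    bounded because [C] is [A]-bounded.

    The hypothesis on [A + dF(w)] enters only through one energy estimate.
    Let [w] satisfy [w' = - A w + g] in the mild sense. For [x] in the domain
    and any [p], the derivative of [|S_t x|^2] at [t = 0] is at most
    [2 (dF(p) x, x) - 2 alpha |x|^2], and this bound no longer contains [A], so
    it extends to all [x] by density ([semigroup_energy]). Hence, if
    [(g + dF(p(t)) w, w)] is at most [rho exp (- alpha t) ^ 2 |w|] for some
    choice of [p(t)], then [|w(t)| <= (|w(0)| + rho / alpha) exp (- alpha t)]
    ([energy_estimate]). Mild solutions enter through their one-sided
    increments ([evolves]).

    For a difference of two orbits, the mean value theorem applied to
    [(F(u) - F(v), u - v)] gives a point [p] with zero defect, so the flow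
    contracts at rate [alpha]; in particular orbits decay, and uniqueness gives
    the semigroup law. For a difference quotient
    [(T_t (w + e h) - T_t w) / e] the choice [p(t) = T_t w] leaves a defect of
    order [e exp (- alpha t) ^ 2] by Taylor's formula. Two quotients are
    therefore close, and completeness yields the differential [dT_t(w) h]
    together with its linearity, its decay and its Lipschitz dependence on [w]
    ([variation_exists], [variation_combination], [flow_taylor],
    [variation_lipschitz]).

    Every integrand on the half-line is continuous and bounded by a multiple of
    [exp (- alpha t)], so the integrals [J w] of [F(T_t w)] and [N w h] of
    [dF(T_t w) dT_t(w) h] converge, and the estimates above show that [N w] is
    the differential of [J] at [w] ([J_taylor]) and that [N] is Lipschitz in
    [w] wherever [dF] is bounded and Lipschitz along orbits ([N_lipschitz]).
    These properties pass to [M w = - K w + K (J w)]. Integrating the mild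
    equation gives [A^-1 (w - J w)] as the limit of the orbit integrals
    ([lim_integral_flow]), hence the first formula for [M]. Finally
    [J (T_s w)] is [J w] minus the integral of [F] over the first part of the
    orbit; the right derivative of [M (T_s w)] at [s = 0], computed from this
    and from the chain rule, is the equation for [M] ([observer_equation]). *)

(** * Inner products and vector identities *)

Lemma minus_zero_eq {G : AbelianGroup} (x y : G) : minus x y = zero -> x = y.
Proof.
  intros E.
  assert (E1 : plus (minus x y) y = plus zero y) by now rewrite E.
  unfold minus in E1.
  now rewrite <- plus_assoc, plus_opp_l, plus_zero_r, plus_zero_l in E1.
Qed.

Section InnerProduct.
Context {H : Hilbert}.
Implicit Types x y z : H.

Lemma inner_plus_r x y z : inner x (plus y z) = inner x y + inner x z.
Proof.
  rewrite inner_sym, inner_plus_l, (inner_sym _ y), (inner_sym _ z).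
  reflexivity.
Qed.

Lemma inner_scal_r (k : R) x y : inner x (scal k y) = k * inner x y.
Proof. rewrite inner_sym, inner_scal_l, inner_sym. reflexivity. Qed.

Lemma inner_zero_l x : inner zero x = 0.
Proof.
  assert (E := inner_plus_l H zero zero x).
  rewrite (plus_zero_l zero : plus zero zero = zero :> H) in E. lra.
Qed.

Lemma inner_opp_l x y : inner (opp x) y = - inner x y.
Proof.
  assert (E := inner_plus_l H x (opp x) y).
  rewrite (plus_opp_r x : plus x (opp x) = zero), inner_zero_l in E. lra.
Qed.

Lemma inner_opp_r x y : inner x (opp y) = - inner x y.
Proof. rewrite inner_sym, inner_opp_l, inner_sym. reflexivity. Qed.

Lemma inner_zero_r x : inner x zero = 0.
Proof. rewrite inner_sym. apply inner_zero_l. Qed.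

Lemma inner_minus_l x y z : inner (minus x y) z = inner x z - inner y z.
Proof. unfold minus. rewrite inner_plus_l, inner_opp_l. ring. Qed.

Lemma inner_minus_r x y z : inner x (minus y z) = inner x y - inner x z.
Proof. unfold minus. rewrite inner_plus_r, inner_opp_r. ring. Qed.

Lemma inner_ext x y : (forall v, inner x v = inner y v) -> x = y.
Proof.
  intros E.
  assert (E0 : norm (minus x y) = 0).
  { assert (E1 := inner_norm H (minus x y)).
    rewrite inner_minus_l, E, Rminus_diag in E1.
    apply Rsqr_0_uniq. rewrite Rsqr_pow2. now symmetry. }
  apply minus_zero_eq. exact (norm_eq_zero _ E0).
Qed.

End InnerProduct.

(** The algebraic structure of a space may be written in several convertible
    ways inside one term; the patterns below accept all of them. *)
Ltac inner_expand :=
  match goal with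
  | |- context [@inner ?H (@plus ?G ?x ?y) ?z] =>
      replace (@inner H (@plus G x y) z) with (@inner H x z + @inner H y z)
        by (symmetry; exact (inner_plus_l H x y z))
  | |- context [@inner ?H ?z (@plus ?G ?x ?y)] =>
      replace (@inner H z (@plus G x y)) with (@inner H z x + @inner H z y)
        by (symmetry; exact (@inner_plus_r H z x y))
  | |- context [@inner ?H (@minus ?G ?x ?y) ?z] =>
      replace (@inner H (@minus G x y) z) with (@inner H x z - @inner H y z)
        by (symmetry; exact (@inner_minus_l H x y z))
  | |- context [@inner ?H ?z (@minus ?G ?x ?y)] =>
      replace (@inner H z (@minus G x y)) with (@inner H z x - @inner H z y)
        by (symmetry; exact (@inner_minus_r H z x y))
  | |- context [@inner ?H (@opp ?G ?x) ?z] =>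
      replace (@inner H (@opp G x) z) with (- @inner H x z)
        by (symmetry; exact (@inner_opp_l H x z))
  | |- context [@inner ?H ?z (@opp ?G ?x)] =>
      replace (@inner H z (@opp G x)) with (- @inner H z x)
        by (symmetry; exact (@inner_opp_r H z x))
  | |- context [@inner ?H (@scal ?K ?V ?k ?x) ?z] =>
      replace (@inner H (@scal K V k x) z) with (Rmult k (@inner H x z))
        by (symmetry; exact (inner_scal_l H k x z))
  | |- context [@inner ?H ?z (@scal ?K ?V ?k ?x)] =>
      replace (@inner H z (@scal K V k x)) with (Rmult k (@inner H z x))
        by (symmetry; exact (@inner_scal_r H k z x))
  | |- context [@inner ?H (@zero ?G) ?z] =>
      replace (@inner H (@zero G) z) with 0
        by (symmetry; exact (@inner_zero_l H z))
  | |- context [@inner ?H ?z (@zero ?G)] =>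
      replace (@inner H z (@zero G)) with 0
        by (symmetry; exact (@inner_zero_r H z))
  end.

(** A vector is determined by its inner products, which turns a vector
    identity into an identity between real numbers. *)
Ltac vec :=
  apply inner_ext; intro; repeat inner_expand; try ring.

(** * Norms in Hilbert spaces *)

Section Norms.
Context {H : Hilbert}.
Implicit Types x y z : H.

Lemma inner_self x : inner x x = norm x * norm x.
Proof. rewrite inner_norm. ring. Qed.

Lemma norm_nonneg x : 0 <= norm x.
Proof. exact (norm_ge_0 x). Qed.

Lemma norm_zero_H : norm (zero : H) = 0.
Proof. exact norm_zero. Qed.

Lemma norm_scal_H (k : R) x : norm (scal k x) = Rabs k * norm x.
Proof.
  apply Rsqr_inj.
  - exact (norm_ge_0 (scal k x)).
  - apply Rmult_le_pos; [apply Rabs_pos | apply norm_nonneg].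
  - unfold Rsqr. rewrite <- (inner_self (scal k x)). repeat inner_expand.
    rewrite inner_self.
    replace (Rabs k * norm x * (Rabs k * norm x))
      with (Rsqr (Rabs k) * (norm x * norm x)) by (unfold Rsqr; ring).
    rewrite <- Rsqr_abs. unfold Rsqr. ring.
Qed.

Lemma cauchy_schwarz x y : inner x y <= norm x * norm y.
Proof.
  (* this vector vanishes exactly when equality holds *)
  assert (E : inner (minus (scal (norm y) x) (scal (norm x) y))
                    (minus (scal (norm y) x) (scal (norm x) y))
              = 2 * (norm x * norm y) * (norm x * norm y - inner x y)).
  { repeat inner_expand. rewrite (inner_sym H y x), !inner_self. ring. }
  rewrite inner_self in E.
  assert (P := Rle_0_sqr
    (norm (minus (scal (norm y) x) (scal (norm x) y)))).
  unfold Rsqr in P. rewrite E in P.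
  assert (hx := norm_nonneg x). assert (hy := norm_nonneg y).
  destruct (Req_dec (norm x) 0) as [zx | nx].
  { rewrite (norm_eq_zero x zx : x = zero), inner_zero_l, norm_zero_H. lra. }
  destruct (Req_dec (norm y) 0) as [zy | ny].
  { rewrite (norm_eq_zero y zy : y = zero), inner_zero_r, norm_zero_H. lra. }
  assert (0 < norm x * norm y) by (apply Rmult_lt_0_compat; lra).
  nra.
Qed.

Lemma norm_le_of_sqr x (c : R) : 0 <= c -> inner x x <= c * c -> norm x <= c.
Proof.
  intros hc. rewrite inner_self. intros le.
  assert (hx := norm_nonneg x). nra.
Qed.

Lemma norm_le_2 z x y : z = plus x y -> norm z <= norm x + norm y.
Proof. intros ->. exact (norm_triangle x y). Qed.

Lemma norm_opp_H x : norm (opp x) = norm x.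
Proof. exact (norm_opp x). Qed.

Lemma norm_minus_comm x y : norm (minus x y) = norm (minus y x).
Proof.
  rewrite <- (norm_opp_H (minus y x)). f_equal. vec.
Qed.

Lemma norm_minus_triangle x y z :
  norm (minus x z) <= norm (minus x y) + norm (minus y z).
Proof. apply norm_le_2. vec. Qed.

Lemma norm_le_minus x y : norm x <= norm y + norm (minus x y).
Proof. apply norm_le_2. vec. Qed.

Lemma norm_plus_le x y : norm (plus x y) <= norm x + norm y.
Proof. now apply norm_le_2. Qed.

Lemma norm_minus_le x y : norm (minus x y) <= norm x + norm y.
Proof. rewrite <- (norm_opp_H y). now apply norm_le_2. Qed.

Lemma Rabs_norm_minus x y : Rabs (norm x - norm y) <= norm (minus x y).
Proof.
  assert (a := norm_le_minus x y). assert (b := norm_le_minus y x).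
  rewrite norm_minus_comm in b. apply Rabs_le. lra.
Qed.

Lemma eq_of_norm_minus x y : norm (minus x y) <= 0 -> x = y.
Proof.
  intros le. apply minus_zero_eq. apply (norm_eq_zero (minus x y)).
  apply Rle_antisym; [exact le | apply norm_nonneg].
Qed.

Lemma norm_minus_diag x : norm (minus x x) = 0.
Proof.
  rewrite <- norm_zero_H. f_equal. vec.
Qed.

End Norms.

Ltac expand_norm_scal :=
  repeat match goal with
  | |- context [@norm ?K ?W (@scal ?R ?V ?k ?x)] =>
      replace (@norm K W (@scal R V k x)) with (Rabs k * @norm K W x)
        by (symmetry; exact (norm_scal_H k x))
  end.

(** * Linear maps and the operator norm *)

Section Linear.
Context {H V : Hilbert}.
Implicit Types (x y : H) (f : H -> V).

Lemma lin_plus f : is_linear f -> forall x y, f (plus x y) = plus (f x) (f y).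
Proof. exact (linear_plus f). Qed.

Lemma lin_scal f :
  is_linear f -> forall (k : R) x, f (scal k x) = scal k (f x).
Proof. exact (linear_scal f). Qed.

Lemma lin_zero f : is_linear f -> f zero = zero.
Proof. exact (linear_zero f). Qed.

Lemma lin_opp f : is_linear f -> forall x, f (opp x) = opp (f x).
Proof. exact (fun hf x => linear_opp f x hf). Qed.

Lemma lin_minus f :
  is_linear f -> forall x y, f (minus x y) = minus (f x) (f y).
Proof.
  intros hf x y. unfold minus.
  now rewrite (lin_plus f hf), (lin_opp f hf).
Qed.

Lemma lin_continuous f : is_linear f -> forall x, continuous f x.
Proof. exact (fun hf x => linear_cont f x hf). Qed.

Lemma lin_bound f :
  is_linear f -> exists c, 0 < c /\ forall x, norm (f x) <= c * norm x.
Proof. exact (linear_norm f). Qed.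

Lemma op_norm_le f (c : R) :
  0 <= c -> (forall x, norm (f x) <= c * norm x) -> Rbar_le (op_norm f) c.
Proof.
  intros hc hf. apply Lub_Rbar_correct. intros r [x [hx ->]].
  apply Rle_trans with (1 := hf x). simpl. nra.
Qed.

Lemma le_op_norm f (c : R) :
  (forall (k : R) x, f (scal k x) = scal k (f x)) ->
  Rbar_le (op_norm f) c -> forall x, norm (f x) <= c * norm x.
Proof.
  intros hf hc x.
  destruct (Req_dec (norm x) 0) as [zx | nx].
  { assert (E : x = scal 0 x) by (rewrite (norm_eq_zero x zx : x = zero); vec).
    rewrite E, hf, !norm_scal_H, Rabs_R0. lra. }
  assert (px := norm_nonneg x).
  assert (B : Rbar_le (norm (f (scal (/ norm x) x))) c).
  { eapply Rbar_le_trans; [| exact hc].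
    apply (Lub_Rbar_correct (fun r => exists h, norm h <= 1 /\ r = norm (f h))).
    exists (scal (/ norm x) x). split; [| reflexivity].
    rewrite norm_scal_H, Rabs_pos_eq.
    - right. now field.
    - left. apply Rinv_0_lt_compat. lra. }
  simpl in B. rewrite hf, norm_scal_H, Rabs_pos_eq in B.
  - apply Rmult_le_reg_l with (/ norm x).
    + apply Rinv_0_lt_compat. lra.
    + rewrite <- Rmult_assoc, (Rmult_comm _ c), Rmult_assoc, Rinv_l, Rmult_1_r;
        lra.
  - left. apply Rinv_0_lt_compat. lra.
Qed.

End Linear.

(** * Calculus on the half-line *)

Section LittleO.
Context {V : Hilbert}.
Implicit Types (r u : R -> V) (y : V).

(** One-sided derivatives are expressed through [r h = o (h)] as [h]
    decreases to [0]: semigroups have no values at negative times. *)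
Definition little_o r : Prop :=
  forall e, 0 < e ->
    exists d, 0 < d /\ forall h, 0 < h < d -> norm (r h) <= e * h.

Lemma little_o_ext r r' :
  (forall h, 0 < h -> r h = r' h) -> little_o r -> little_o r'.
Proof.
  intros E o e he. destruct (o e he) as [d [hd B]].
  exists d. split; [easy |]. intros h hh. rewrite <- E by lra. now apply B.
Qed.

Lemma little_o_plus r r' :
  little_o r -> little_o r' -> little_o (fun h => plus (r h) (r' h)).
Proof.
  intros o o' e he.
  destruct (o (e / 2)) as [d [hd B]]; [lra |].
  destruct (o' (e / 2)) as [d' [hd' B']]; [lra |].
  exists (Rmin d d'). split; [now apply Rmin_glb_lt |].
  intros h [h0 h1].
  assert (l := Rmin_l d d'). assert (l' := Rmin_r d d').
  apply Rle_trans with (1 := norm_plus_le _ _).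
  assert (hr := B h ltac:(lra)). assert (hr' := B' h ltac:(lra)). lra.
Qed.

Lemma little_o_opp r : little_o r -> little_o (fun h => opp (r h)).
Proof.
  intros o e he. destruct (o e he) as [d [hd B]]. exists d.
  split; [easy |]. intros h hh. rewrite norm_opp_H. now apply B.
Qed.

Lemma filterlim_at_right_norm u y :
  filterlim u (at_right 0) (locally y) <->
  forall e, 0 < e -> exists d, 0 < d /\
    forall h, 0 < h < d -> norm (minus (u h) y) <= e.
Proof.
  rewrite (filterlim_locally_ball_norm u y). split.
  - intros L e he. destruct (L (mkposreal e he)) as [d B].
    exists d. split; [apply cond_pos |]. intros h hh.
    left. apply B; [| easy].
    change (Rabs (h - 0) < d). rewrite Rminus_0_r, Rabs_pos_eq; lra.
  - intros L e. destruct (L (e / 2)) as [d [hd B]].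
    { assert (he := cond_pos e). lra. }
    exists (mkposreal d hd). intros h hh h0.
    change (Rabs (h - 0) < d) in hh.
    rewrite Rminus_0_r, Rabs_pos_eq in hh by lra.
    assert (he := cond_pos e).
    change (norm (minus (u h) y) < e). specialize (B h). lra.
Qed.

Lemma filterlim_quotient u y :
  filterlim (fun h => scal (/ h) (u h)) (at_right 0) (locally y) <->
  little_o (fun h => minus (u h) (scal h y)).
Proof.
  rewrite filterlim_at_right_norm.
  assert (E : forall h, 0 < h ->
    norm (minus (u h) (scal h y)) = h * norm (minus (scal (/ h) (u h)) y)).
  { intros h h0.
    replace (minus (u h) (scal h y))
      with (scal h (minus (scal (/ h) (u h)) y)) by (vec; field; lra).
    rewrite norm_scal_H, Rabs_pos_eq; lra. }
  split; intros L e he; destruct (L e he) as [d [hd B]];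
    exists d; (split; [easy |]); intros h hh; specialize (B h hh).
  - rewrite E by lra. rewrite (Rmult_comm e).
    apply Rmult_le_compat_l; [lra | exact B].
  - rewrite E in B by lra. rewrite (Rmult_comm e) in B.
    apply Rmult_le_reg_l with h; [lra | exact B].
Qed.

Lemma continuous_on_half_line u :
  continuous_on (fun t => 0 <= t) u <->
  forall t, 0 <= t -> forall e, 0 < e -> exists d, 0 < d /\
    forall s, 0 <= s -> Rabs (s - t) < d -> norm (minus (u s) (u t)) <= e.
Proof.
  split; intros L t ht.
  - intros e he.
    assert (L1 := proj1 (filterlim_locally_ball_norm u (u t)) (L t ht)
      (mkposreal e he)).
    destruct L1 as [d B]. exists d. split; [apply cond_pos |].
    intros s hs st. left. now apply B.
  - apply (filterlim_locally_ball_norm u (u t)). intros e.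
    destruct (L t ht (e / 2)) as [d [hd B]].
    { assert (he := cond_pos e). lra. }
    exists (mkposreal d hd). intros s st hs.
    assert (he := cond_pos e).
    change (norm (minus (u s) (u t)) < e). specialize (B s hs st). lra.
Qed.

End LittleO.

Lemma little_o_linear {V W : Hilbert} (f : V -> W) r :
  is_linear f -> little_o r -> little_o (fun h => f (r h)).
Proof.
  intros hf o e he. destruct (lin_bound f hf) as [c [hc Bf]].
  destruct (o (e / c)) as [d [hd B]]; [now apply Rdiv_lt_0_compat |].
  exists d. split; [easy |]. intros h hh.
  apply Rle_trans with (1 := Bf _). specialize (B h hh).
  replace (e * h) with (c * (e / c * h)) by (field; lra).
  now apply Rmult_le_compat_l; [lra |].
Qed.

Lemma continuous_on_minus {V : Hilbert} (u v : R -> V) :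
  continuous_on (fun t => 0 <= t) u -> continuous_on (fun t => 0 <= t) v ->
  continuous_on (fun t => 0 <= t) (fun t : R => minus (u t) (v t)).
Proof.
  intros cu cv. apply continuous_on_half_line. intros t ht e he.
  destruct (proj1 (continuous_on_half_line u) cu t ht (e / 2))
    as [d1 [hd1 B1]]; [lra |].
  destruct (proj1 (continuous_on_half_line v) cv t ht (e / 2))
    as [d2 [hd2 B2]]; [lra |].
  exists (Rmin d1 d2). split; [now apply Rmin_glb_lt |].
  intros s hs st.
  assert (l1 := Rmin_l d1 d2). assert (l2 := Rmin_r d1 d2).
  specialize (B1 s hs ltac:(lra)). specialize (B2 s hs ltac:(lra)).
  apply Rle_trans with
    (norm (minus (minus (u s) (u t)) (minus (v s) (v t)))).
  - right. f_equal. vec.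
  - apply Rle_trans with (1 := norm_minus_le _ _). lra.
Qed.

Lemma continuous_on_comp {V W : Hilbert} (f : V -> W) (u : R -> V) :
  (forall x, continuous f x) -> continuous_on (fun t => 0 <= t) u ->
  continuous_on (fun t => 0 <= t) (fun t : R => f (u t)).
Proof.
  intros cf cu t ht.
  eapply filterlim_comp; [exact (cu t ht) | exact (cf (u t))].
Qed.

(** A continuous function cannot become negative if it is nonnegative for a
    short time after each of its zeros. Comparison functions are chosen so that
    differential inequalities need to be checked at these zeros only. *)
Lemma nonneg_of_contact (f : R -> R) (b : R) :
  (forall t, 0 <= t <= b -> forall e, 0 < e -> exists d, 0 < d /\
     forall s, 0 <= s -> Rabs (s - t) < d -> Rabs (f s - f t) <= e) ->
  0 <= b -> 0 <= f 0 ->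
  (forall t, 0 <= t < b -> f t = 0 ->
     exists d, 0 < d /\ forall h, 0 < h < d -> 0 <= f (t + h)) ->
  0 <= f b.
Proof.
  intros cf hb f0 contact.
  destruct (Rle_or_lt 0 (f b)) as [fb | fb]; [easy | exfalso].
  (* [s], the supremum of [E], is the last point where [f] is nonnegative *)
  pose (E := fun t => 0 <= t <= b /\ 0 <= f t).
  destruct (completeness E) as [s [ub lub]].
  { exists b. intros t [[_ tb] _]. exact tb. }
  { exists 0. split; [lra | easy]. }
  assert (hs : 0 <= s <= b).
  { split; [apply ub; split; [lra | easy] |].
    apply lub. intros t [[_ tb] _]. exact tb. }
  assert (fs : 0 <= f s).
  { destruct (Rle_or_lt 0 (f s)) as [fs | fs]; [easy | exfalso].
    destruct (cf s hs (- f s / 2)) as [d [hd B]]; [lra |].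
    assert (s <= s - d).
    { apply lub. intros t [ht ft].
      destruct (Rle_or_lt t (s - d)) as [le | lt]; [easy | exfalso].
      assert (ts : t <= s) by (apply ub; now split).
      assert (A := B t ltac:(lra) ltac:(apply Rabs_def1; lra)).
      apply Rabs_le_between in A. lra. }
    lra. }
  assert (sb : s < b).
  { destruct (Req_dec s b) as [-> |]; lra. }
  assert (up : exists h, 0 < h /\ s + h <= b /\ 0 <= f (s + h)).
  { destruct (Req_dec (f s) 0) as [z | nz].
    - destruct (contact s ltac:(lra) z) as [d [hd B]].
      exists (Rmin (d / 2) (b - s)).
      assert (l := Rmin_l (d / 2) (b - s)).
      assert (l' := Rmin_r (d / 2) (b - s)).
      assert (0 < Rmin (d / 2) (b - s)) by (apply Rmin_glb_lt; lra).
      repeat split; [easy | lra |]. apply B. lra.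
    - destruct (cf s hs (f s)) as [d [hd B]]; [lra |].
      exists (Rmin (d / 2) (b - s)).
      assert (l := Rmin_l (d / 2) (b - s)).
      assert (l' := Rmin_r (d / 2) (b - s)).
      assert (0 < Rmin (d / 2) (b - s)) by (apply Rmin_glb_lt; lra).
      repeat split; [easy | lra |].
      assert (A := B (s + Rmin (d / 2) (b - s)) ltac:(lra)
                     ltac:(apply Rabs_def1; lra)).
      apply Rabs_le_between in A. lra. }
  destruct up as [h [h0 [h1 h2]]].
  assert (s + h <= s) by (apply ub; split; [lra | easy]). lra.
Qed.

(** If the right derivative vanishes everywhere, then the function stays
    within [e * (t + 1)] of its initial value for each [e > 0]. *)
Lemma constant_of_right_derivative {V : Hilbert} (u : R -> V) :
  continuous_on (fun t => 0 <= t) u ->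
  (forall t, 0 <= t -> little_o (fun h => minus (u (t + h)) (u t))) ->
  forall t, 0 <= t -> u t = u 0.
Proof.
  intros cu du t ht.
  apply eq_of_norm_minus.
  apply le_epsilon. intros e he.
  pose (c := e / (t + 1)).
  assert (hc : 0 < c) by (apply Rdiv_lt_0_compat; lra).
  assert (G : 0 <= c * (t + 1) - norm (minus (u t) (u 0))).
  2:{ replace (c * (t + 1)) with e in G by (unfold c; field; lra).
      change (norm (minus (u t) (u 0)) <= 0 + e). lra. }
  apply (nonneg_of_contact (fun s => c * (s + 1) - norm (minus (u s) (u 0))));
    [| easy | |].
  - intros s hs k hk.
    destruct (proj1 (continuous_on_half_line u) cu s (proj1 hs) (k / 2))
      as [d [hd B]]; [lra |].
    exists (Rmin d (k / 2 / c)).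
    assert (0 < k / 2 / c) by (apply Rdiv_lt_0_compat; lra).
    split; [now apply Rmin_glb_lt |].
    intros s' hs' near.
    assert (l := Rmin_l d (k / 2 / c)). assert (l' := Rmin_r d (k / 2 / c)).
    assert (B1 := B s' hs' ltac:(lra)).
    assert (B2 := Rabs_norm_minus (minus (u s') (u 0)) (minus (u s) (u 0))).
    replace (minus (minus (u s') (u 0)) (minus (u s) (u 0)))
      with (minus (u s') (u s)) in B2 by vec.
    assert (B3 : c * Rabs (s' - s) <= k / 2).
    { apply Rle_trans with (c * (k / 2 / c)).
      - apply Rmult_le_compat_l; lra.
      - right. field. lra. }
    apply Rabs_le_between in B2.
    rewrite <- (Rabs_pos_eq c), <- Rabs_mult in B3 by lra.
    apply Rabs_le_between in B3. apply Rabs_le. lra.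
  - rewrite norm_minus_diag. lra.
  - intros s hs E.
    destruct (du s (proj1 hs) c hc) as [d [hd B]].
    exists d. split; [easy |]. intros h hh. specialize (B h hh).
    assert (tri := norm_minus_triangle (u (s + h)) (u s) (u 0)). lra.
Qed.

(** * Integrals of Hilbert-valued functions *)

Lemma is_RInt_linear {V W : Hilbert} (f : V -> W) (u : R -> V) (a b : R)
    (I : V) :
  is_linear f -> is_RInt u a b I -> is_RInt (fun t => f (u t)) a b (f I).
Proof.
  intros hf hu.
  assert (L : filterlim (fun p => f (scal (sign (b - a)) (Riemann_sum u p)))
                (Riemann_fine a b) (locally (f I))).
  { eapply filterlim_comp; [exact hu | exact (linear_cont f I hf)]. }
  unfold is_RInt. eapply filterlim_ext; [| exact L].
  intros p. cbv beta. rewrite (lin_scal f hf). f_equal.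
  induction p as [x | x p IH] using SF_cons_ind.
  - exact (lin_zero f hf).
  - rewrite !Riemann_sum_cons.
    etransitivity; [apply (lin_plus f hf) |].
    rewrite IH. f_equal. apply (lin_scal f hf).
Qed.

Lemma ex_RInt_half_line {V : CompleteNormedModule R_AbsRing} (u : R -> V) a b :
  continuous_on (fun t => 0 <= t) u -> 0 <= a <= b -> ex_RInt u a b.
Proof.
  intros cu hab.
  (* [u] says nothing about negative times, so it is made constant there *)
  apply ex_RInt_ext with (fun t => u (Rmax 0 t)).
  { intros t ht. rewrite Rmin_left, Rmax_right in ht by lra.
    now rewrite Rmax_right by lra. }
  apply ex_RInt_continuous. intros t ht.
  rewrite Rmin_left, Rmax_right in ht by lra.
  intros P HP.
  assert (L := cu (Rmax 0 t) (Rmax_l 0 t) P HP). unfold filtermap, within in L.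
  destruct L as [d B]. exists d. intros s hs.
  apply (B (Rmax 0 s)); [| apply Rmax_l].
  change (Rabs (Rmax 0 s - Rmax 0 t) < d). change (Rabs (s - t) < d) in hs.
  apply Rle_lt_trans with (2 := hs).
  rewrite (Rmax_right 0 t) by lra. apply Rabs_le.
  assert (m := Rmax_r 0 s).
  destruct (Rle_or_lt 0 (s - t)) as [le | lt].
  - rewrite Rabs_pos_eq by easy. rewrite Rmax_right by lra. lra.
  - rewrite Rabs_left by easy. split; [lra |].
    assert (Rmax 0 s <= t) by (apply Rmax_lub; lra). lra.
Qed.

Section Integrals.
Context {V : Hilbert}.
Implicit Types (u : R -> V) (x y : V).

Lemma is_RInt_near_constant u y (a b e : R) (I : V) :
  a <= b -> is_RInt u a b I ->
  (forall t, a <= t <= b -> norm (minus (u t) y) <= e) ->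
  norm (minus I (scal (b - a) y)) <= e * (b - a).
Proof.
  intros hab hI B. rewrite Rmult_comm.
  exact (norm_RInt_le_const (fun t => minus (u t) y) a b _ e hab B
    (is_RInt_minus u (fun _ => y) a b I _ hI (is_RInt_const a b y))).
Qed.

Lemma little_o_RInt u t (I : R -> V) :
  continuous_on (fun t => 0 <= t) u -> 0 <= t ->
  (forall h, 0 < h -> is_RInt u t (t + h) (I h)) ->
  little_o (fun h => minus (I h) (scal h (u t))).
Proof.
  intros cu ht hI e he.
  destruct (proj1 (continuous_on_half_line u) cu t ht e he) as [d [hd B]].
  exists d. split; [easy |]. intros h hh.
  replace h with (t + h - t) at 2 3 by ring.
  apply (is_RInt_near_constant u (u t) t (t + h) e (I h)).
  - lra.
  - apply hI. lra.
  - intros s hs. apply B; [lra |]. apply Rabs_def1; lra.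
Qed.

Lemma is_lim_integral_intro u (I : R -> V) (l : V) :
  (forall b, 0 <= b -> is_RInt u 0 b (I b)) ->
  filterlim I (Rbar_locally p_infty) (locally l) ->
  is_lim_integral u l.
Proof.
  intros hI lim P HP.
  apply (Filter_prod _ _ _ (fun a => a = 0) (fun b => 0 <= b /\ P (I b))).
  - reflexivity.
  - apply filter_and; [| exact (lim P HP)].
    exists 0. intros b hb. now left.
  - intros a b -> [hb Pb]. exists (I b). split; [now apply hI | exact Pb].
Qed.

Lemma filterlim_p_infty_norm (I : R -> V) (l : V) :
  filterlim I (Rbar_locally p_infty) (locally l) <->
  forall e, 0 < e -> exists m, forall b, m < b -> norm (minus (I b) l) <= e.
Proof.
  rewrite (filterlim_locally_ball_norm I l). split.
  - intros L e he. destruct (L (mkposreal e he)) as [m B].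
    exists m. intros b hb. left. now apply B.
  - intros L e. assert (he := cond_pos e).
    destruct (L (e / 2)) as [m B]; [lra |]. exists m. intros b hb.
    change (norm (minus (I b) l) < e). specialize (B b hb). lra.
Qed.

End Integrals.

(** * Exponentially decaying integrands *)

(** The real line as a Hilbert space, so that results on vector-valued
    integrals also apply to the norm of the integrand. *)
Definition R_Hilbert : Hilbert.
Proof.
  refine {| hilbert_space := R_CompleteNormedModule;
            inner := fun x y : R => x * y |}.
  - intros x y. apply Rmult_comm.
  - intros x y z. apply Rmult_plus_distr_r.
  - intros k x y. apply Rmult_assoc.
  - intros x. change (x * x = Rabs x ^ 2). rewrite pow2_abs. ring.
Defined.

Section Decay.
Context (alpha : R) (alpha_pos : 0 < alpha).

Lemma exp_decay_le (t : R) : 0 <= t -> 0 < exp (- alpha * t) <= 1.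
Proof.
  intros ht. split; [apply exp_pos |].
  rewrite <- exp_0. destruct (Req_dec t 0) as [-> | nz].
  - right. f_equal. ring.
  - left. apply exp_increasing. nra.
Qed.

Lemma exp_decay_small (e : R) :
  0 < e -> exists m, 0 <= m /\ forall t, m <= t -> exp (- alpha * t) <= e.
Proof.
  intros he. exists (Rmax 0 (- ln e / alpha)). split; [apply Rmax_l |].
  intros t ht. assert (m := Rmax_r 0 (- ln e / alpha)).
  rewrite <- (exp_ln e he).
  assert (le : - alpha * t <= ln e).
  { assert (E : alpha * (- ln e / alpha) = - ln e) by (field; lra). nra. }
  destruct le as [lt | ->]; [left; now apply exp_increasing | now right].
Qed.

Lemma is_RInt_exp_decay (D a b : R) :
  is_RInt (fun t => D * exp (- alpha * t)) a b
    (D / alpha * (exp (- alpha * a) - exp (- alpha * b))).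
Proof.
  replace (D / alpha * (exp (- alpha * a) - exp (- alpha * b))) with
    (minus (- D / alpha * exp (- alpha * b)) (- D / alpha * exp (- alpha * a)))
    by (unfold minus, plus, opp; simpl; field; lra).
  apply (is_RInt_derive (fun t => - D / alpha * exp (- alpha * t))).
  - intros t _. auto_derive; [easy |]. field. lra.
  - intros t _. apply (ex_derive_continuous (fun t => D * exp (- alpha * t))).
    auto_derive. easy.
Qed.

Lemma is_lim_integral_exp_decay (D : R) :
  is_lim_integral (fun t => D * exp (- alpha * t)) (D / alpha).
Proof.
  apply (is_lim_integral_intro (V := R_Hilbert) _
    (fun b => D / alpha * (1 - exp (- alpha * b)))).
  - intros b _. assert (I := is_RInt_exp_decay D 0 b).
    now rewrite Rmult_0_r, exp_0 in I.
  - apply (filterlim_p_infty_norm (V := R_Hilbert)). intros e he.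
    destruct (exp_decay_small (e / (1 + Rabs (D / alpha)))) as [m [hm B]].
    { assert (p := Rabs_pos (D / alpha)). apply Rdiv_lt_0_compat; lra. }
    exists m. intros b hb.
    change (Rabs (D / alpha * (1 - exp (- alpha * b)) - D / alpha) <= e).
    replace (D / alpha * (1 - exp (- alpha * b)) - D / alpha)
      with (- (D / alpha) * exp (- alpha * b)) by ring.
    rewrite Rabs_mult, Rabs_Ropp, (Rabs_pos_eq (exp _))
      by (left; apply exp_pos).
    assert (p := Rabs_pos (D / alpha)).
    apply Rle_trans
      with ((1 + Rabs (D / alpha)) * (e / (1 + Rabs (D / alpha)))).
    + apply Rmult_le_compat; [easy | left; apply exp_pos | lra |].
      apply B. lra.
    + right. field. lra.
Qed.

Lemma norm_lim_integral_le {V : Hilbert} (u : R -> V) (l : V) (D : R) :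
  (forall t, 0 <= t -> norm (u t) <= D * exp (- alpha * t)) ->
  is_lim_integral u l -> norm l <= D / alpha.
Proof.
  intros B hl.
  apply (RInt_gen_norm (Fa := at_point 0) (Fb := Rbar_locally p_infty) u
    (fun t => D * exp (- alpha * t))); [| | exact hl |].
  - apply (Filter_prod _ _ _ (fun a => a = 0) (fun b => 0 <= b)).
    + reflexivity.
    + exists 0. intros b hb. now left.
    + intros a b -> hb. exact hb.
  - apply (Filter_prod _ _ _ (fun a => a = 0) (fun b => 0 <= b)).
    + reflexivity.
    + exists 0. intros b hb. now left.
    + intros a b -> hb t ht. simpl in ht. now apply B.
  - exact (is_lim_integral_exp_decay D).
Qed.

Lemma ex_lim_integral {V : Hilbert} (u : R -> V) (D : R) :
  continuous_on (fun t => 0 <= t) u ->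
  (forall t, 0 <= t -> norm (u t) <= D * exp (- alpha * t)) ->
  exists l, is_lim_integral u l.
Proof.
  intros cu B.
  assert (hI : forall a b, 0 <= a <= b -> is_RInt u a b (RInt u a b)).
  { intros a b hab. apply RInt_correct. now apply ex_RInt_half_line. }
  assert (D0 : 0 <= D / alpha).
  { assert (B0 := B 0 (Rle_refl 0)).
    rewrite Rmult_0_r, exp_0 in B0. assert (p := norm_nonneg (u 0)).
    apply Rle_mult_inv_pos; lra. }
  assert (tail : forall a b, 0 <= a <= b ->
    norm (minus (RInt u 0 b) (RInt u 0 a)) <= D / alpha * exp (- alpha * a)).
  { intros a b hab.
    assert (E : minus (RInt u 0 b) (RInt u 0 a) = RInt u a b).
    { rewrite <- (RInt_Chasles u 0 a b) 
        by (apply ex_RInt_half_line; [exact cu | split; lra]).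
      vec. }
    rewrite E.
    apply Rle_trans
      with (D / alpha * (exp (- alpha * a) - exp (- alpha * b))).
    - apply (norm_RInt_le u (fun t => D * exp (- alpha * t)) a b); try lra.
      + intros t ht. apply B. lra.
      + now apply hI.
      + apply is_RInt_exp_decay.
    - assert (p := exp_pos (- alpha * b)). nra. }
  destruct (proj1 (filterlim_locally_cauchy (U := V)
    (F := Rbar_locally p_infty) (fun b => RInt u 0 b))) as [l hl].
  - intros e. assert (he := cond_pos e).
    destruct (exp_decay_small (e / 2 / (1 + D / alpha))) as [m [hm Bm]].
    { apply Rdiv_lt_0_compat; lra. }
    exists (fun b => m < b). split; [now exists m |].
    assert (C : forall a b, m < a <= b ->
      norm (minus (RInt u 0 b) (RInt u 0 a)) < e).
    { intros a b hab. apply Rle_lt_trans with (1 := tail a b ltac:(lra)).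
      assert (s := Bm a ltac:(lra)).
      assert (p := exp_pos (- alpha * a)).
      apply Rle_lt_trans with ((1 + D / alpha) * (e / 2 / (1 + D / alpha))).
      - apply Rmult_le_compat; lra.
      - unfold Rdiv at 2. rewrite (Rmult_comm (e / 2)), <- Rmult_assoc.
        rewrite Rinv_r; lra. }
    intros a b ha hb. apply (norm_compat1 (V := V)).
    destruct (Rle_or_lt a b) as [ab | ba].
    + now apply C.
    + change (norm (minus (RInt u 0 b) (RInt u 0 a)) < e).
      rewrite norm_minus_comm. apply C. lra.
  - exists l. apply (is_lim_integral_intro u (fun b => RInt u 0 b)); [| easy].
    intros b hb. apply hI. lra.
Qed.

Lemma continuous_on_norm {V : Hilbert} (u : R -> V) :
  continuous_on (fun t => 0 <= t) u ->
  continuous_on (U := R_Hilbert) (fun t => 0 <= t) (fun t => norm (u t)).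
Proof.
  intros cu t ht. eapply filterlim_comp; [exact (cu t ht) |].
  exact (filterlim_norm (u t)).
Qed.

Lemma ex_integral_0_infty {V : Hilbert} (u : R -> V) (D : R) :
  continuous_on (fun t => 0 <= t) u ->
  (forall t, 0 <= t -> norm (u t) <= D * exp (- alpha * t)) ->
  exists l, is_integral_0_infty u l.
Proof.
  intros cu B. destruct (ex_lim_integral u D cu B) as [l hl].
  destruct (ex_lim_integral (V := R_Hilbert) (fun t => norm (u t)) D)
    as [n hn].
  - now apply continuous_on_norm.
  - intros t ht. change (Rabs (norm (u t)) <= D * exp (- alpha * t)).
    rewrite Rabs_pos_eq by apply norm_nonneg. now apply B.
  - exists l. split; [easy |]. now exists n.
Qed.

End Decay.

Lemma lim_integral_elim {V : Hilbert} (u : R -> V) (l : V) :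
  is_lim_integral u l ->
  forall e, 0 < e -> exists m, 0 <= m /\
    forall b, m < b -> norm (minus (RInt u 0 b) l) <= e.
Proof.
  intros hl e he.
  assert (near : locally l (fun y => norm (minus y l) < e)).
  { apply (locally_le_locally_norm l).
    exists (mkposreal e he). now intros y hy. }
  destruct (hl _ near) as [P Q hP [m hm] hPQ].
  exists (Rmax 0 m). split; [apply Rmax_l |]. intros b hb.
  assert (m0 := Rmax_r 0 m).
  destruct (hPQ 0 b hP (hm b ltac:(lra))) as [y [hy B]].
  cbn [fst snd] in hy.
  rewrite (is_RInt_unique _ _ _ _ hy). now left.
Qed.

(** With [D = 0] this gives uniqueness of the limit and shows that it depends
    only on the values at nonnegative times. *)
Lemma lim_integral_distance (alpha : R) {V : Hilbert} (u v : R -> V) (l m : V)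
    (D : R) :
  0 < alpha -> is_lim_integral u l -> is_lim_integral v m ->
  (forall t, 0 <= t -> norm (minus (u t) (v t)) <= D * exp (- alpha * t)) ->
  norm (minus l m) <= D / alpha.
Proof.
  intros ha hu hv B.
  apply (norm_lim_integral_le alpha ha (fun t => minus (u t) (v t))); [easy |].
  exact (is_RInt_gen_minus u v l m hu hv).
Qed.

Lemma continuous_on_RInt {V : Hilbert} (u : R -> V) (c : R) :
  continuous_on (fun t => 0 <= t) u ->
  (forall t, 0 <= t -> norm (u t) <= c) ->
  continuous_on (fun t => 0 <= t) (fun b : R => RInt u 0 b).
Proof.
  intros cu B.
  assert (hc : 0 <= c).
  { apply Rle_trans with (2 := B 0 (Rle_refl 0)). apply norm_nonneg. }
  assert (X : forall a b, 0 <= a <= b -> ex_RInt u a b)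
    by (intros a b hab; now apply ex_RInt_half_line).
  assert (step : forall a b, 0 <= a <= b ->
    norm (minus (RInt u 0 b) (RInt u 0 a)) <= (b - a) * c).
  { intros a b hab.
    assert (E : minus (RInt u 0 b) (RInt u 0 a) = RInt u a b).
    { rewrite <- (RInt_Chasles u 0 a b); [vec | apply X | apply X]; lra. }
    rewrite E.
    apply (norm_RInt_le_const u a b); [lra | |].
    - intros t ht. apply B. lra.
    - apply RInt_correct. now apply X. }
  apply continuous_on_half_line. intros t ht e he.
  assert (pe : 0 < e / (c + 1)) by (apply Rdiv_lt_0_compat; lra).
  exists (e / (c + 1)). split; [easy |].
  assert (small : forall r, 0 <= r < e / (c + 1) -> r * c <= e).
  { intros r hr. apply Rle_trans with (e / (c + 1) * (c + 1)).
    - apply Rmult_le_compat; lra.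
    - right. field. lra. }
  intros s hs st. apply Rabs_def2 in st.
  destruct (Rle_or_lt t s).
  - apply Rle_trans with (1 := step t s ltac:(lra)). apply small. lra.
  - rewrite norm_minus_comm.
    apply Rle_trans with (1 := step s t ltac:(lra)). apply small. lra.
Qed.

Lemma little_o_scal_zero {V : Hilbert} (v : V) :
  little_o (fun h => scal h v) -> v = zero.
Proof.
  intros o. apply eq_of_norm_minus.
  apply Rle_trans with (norm v); [right; f_equal; vec |].
  apply le_epsilon. intros e he.
  destruct (o e he) as [d [hd B]].
  specialize (B (d / 2) ltac:(lra)).
  rewrite norm_scal_H, Rabs_pos_eq in B by lra.
  apply Rmult_le_reg_l with (d / 2); lra.
Qed.

(** * Strongly continuous semigroups *)

Lemma cauchy_sequence_converges {V : Hilbert} (x : nat -> V) :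
  (forall e, 0 < e -> exists N, forall n m, (N <= n)%nat -> (N <= m)%nat ->
     norm (minus (x n) (x m)) <= e) ->
  exists l, forall e, 0 < e -> exists N, forall n, (N <= n)%nat ->
    norm (minus (x n) l) <= e.
Proof.
  intros C.
  destruct (proj1 (filterlim_locally_cauchy (U := V) (F := eventually) x))
    as [l hl].
  - intros e. assert (he := cond_pos e). destruct (C (e / 2)) as [N B]; [lra |].
    exists (fun n => (N <= n)%nat). split; [now exists N |].
    intros n m hn hm. apply (norm_compat1 (V := V)).
    apply Rle_lt_trans with (e / 2); [exact (B m n hm hn) | lra].
  - exists l. intros e he.
    destruct (proj1 (filterlim_locally_ball_norm x l) hl (mkposreal e he))
      as [N B].
    exists N. intros n hn. left. now apply B.
Qed.

Section Semigroup.
Context {H : Hilbert} (S : R -> H -> H) (hS : is_C0_semigroup S).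

Lemma semigroup_linear t : 0 <= t -> is_linear (S t).
Proof. apply hS. Qed.

Lemma semigroup_0 x : S 0 x = x.
Proof. apply hS. Qed.

Lemma semigroup_plus s t x : 0 <= s -> 0 <= t -> S (s + t) x = S s (S t x).
Proof. apply hS. Qed.

Lemma semigroup_right_continuous x e :
  0 < e -> exists d, 0 < d /\
    forall h, 0 <= h < d -> norm (minus (S h x) x) <= e.
Proof.
  intros he.
  destruct (proj1 (filterlim_at_right_norm (fun t => S t x) x)
              (proj2 (proj2 (proj2 hS)) x) e he) as [d [hd B]].
  exists d. split; [easy |]. intros h hh.
  destruct (Req_dec h 0) as [-> | nz]; [| apply B; lra].
  rewrite semigroup_0. apply Rle_trans with (norm (zero : H)).
  - right. f_equal. vec.
  - rewrite norm_zero_H. lra.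
Qed.

(** A nested-ball argument: if no bound held near [0], then every ball would
    contain a smaller one on which some [S t] with small [t] is large, and a
    point common to a sequence of such balls would contradict right continuity
    at [0]. *)
Lemma semigroup_bounded_near_0 :
  exists d c, 0 < d /\ 0 < c /\
    forall t x, 0 <= t <= d -> norm (S t x) <= c * norm x.
Proof.
  destruct (classic (exists d c, 0 < d /\ 0 < c /\
    forall t x, 0 <= t <= d -> norm (S t x) <= c * norm x)) as [| none];
    [easy | exfalso].
  (* [p] is an index with a ball, given by centre and radius; [q] is a ball *)
  assert (step : forall p : nat * (H * R), exists q : H * R,
    0 < snd (snd p) ->
    0 < snd q <= snd (snd p) / 2 /\
    norm (minus (fst q) (fst (snd p))) + snd q <= snd (snd p) /\
    exists t, 0 <= t <= / (INR (fst p) + 1) /\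
      forall y, norm (minus y (fst q)) <= snd q -> INR (fst p) <= norm (S t y)).
  { intros [n [x r]]. simpl.
    destruct (classic (0 < r)) as [hr |]; [| now exists (x, r)].
    assert (hn := pos_INR n).
    assert (large : exists y t, norm (minus y x) <= r / 2 /\
      0 <= t <= / (INR n + 1) /\ INR n + 1 < norm (S t y)).
    { apply NNPP. intros no. apply none.
      exists (/ (INR n + 1)), (4 * (INR n + 1) / r).
      split; [apply Rinv_0_lt_compat; lra |].
      split; [apply Rdiv_lt_0_compat; lra |].
      intros t z ht.
      assert (B : forall y, norm (minus y x) <= r / 2 ->
        norm (S t y) <= INR n + 1).
      { intros y hy. apply Rnot_lt_le. intros lt. apply no. now exists y, t. }
      assert (lin := semigroup_linear t (proj1 ht)).
      destruct (Req_dec (norm z) 0) as [zz | nz].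
      { rewrite (norm_eq_zero z zz : z = zero), (lin_zero _ lin), norm_zero_H.
        lra. }
      assert (pz := norm_nonneg z).
      pose (k := r / 2 / norm z).
      assert (hk : 0 < k) by (apply Rdiv_lt_0_compat; lra).
      assert (E : S t z
                  = scal (/ k) (minus (S t (plus x (scal k z))) (S t x))).
      { rewrite (lin_plus _ lin), (lin_scal _ lin). vec. field. lra. }
      assert (B1 := B (plus x (scal k z))).
      assert (B2 := B x).
      replace (minus (plus x (scal k z)) x) with (scal k z) in B1 by vec.
      rewrite norm_scal_H, Rabs_pos_eq in B1 by lra.
      specialize (B1 ltac:(right; unfold k; field; lra)).
      rewrite norm_minus_diag in B2. specialize (B2 ltac:(lra)).
      rewrite E, norm_scal_H, Rabs_pos_eq
        by (left; now apply Rinv_0_lt_compat).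
      apply Rle_trans with (/ k * (INR n + 1 + (INR n + 1))).
      - apply Rmult_le_compat_l; [left; now apply Rinv_0_lt_compat |].
        apply Rle_trans with (1 := norm_minus_le _ _). lra.
      - right. unfold k. field. lra. }
    destruct large as [y [t [hy [ht big]]]].
    destruct (lin_bound _ (semigroup_linear t (proj1 ht))) as [c [hc Bc]].
    exists (y, Rmin (r / 2) (/ c)). simpl.
    assert (l := Rmin_l (r / 2) (/ c)). assert (l' := Rmin_r (r / 2) (/ c)).
    assert (0 < / c) by now apply Rinv_0_lt_compat.
    split; [split; [apply Rmin_glb_lt; lra | lra] |].
    split; [lra |].
    exists t. split; [easy |]. intros z hz.
    assert (lin := semigroup_linear t (proj1 ht)).
    assert (B := Bc (minus z y)). rewrite (lin_minus _ lin) in B.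
    assert (B' : c * norm (minus z y) <= 1).
    { apply Rle_trans with (c * / c); [| right; field; lra].
      apply Rmult_le_compat_l; lra. }
    assert (tri := norm_le_minus (S t y) (S t z)).
    rewrite norm_minus_comm in tri. lra. }
  destruct (functional_choice _ step) as [f hf].
  pose (s := fix s n := match n with
                        | O => ((zero : H), 1)
                        | Datatypes.S n => f (n, s n) end).
  assert (pos : forall n, 0 < snd (s n)).
  { induction n as [| n IH]; [simpl; lra |]. now apply (hf (n, s n)). }
  assert (nested : forall n k, norm (minus (fst (s (n + k)%nat)) (fst (s n)))
                             + snd (s (n + k)%nat) <= snd (s n)).
  { intros n. induction k as [| k IH].
    - rewrite Nat.add_0_r, norm_minus_diag. lra.
    - rewrite Nat.add_succ_r.
      destruct (hf ((n + k)%nat, s (n + k)%nat) (pos _)) as [_ [B _]].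
      cbn [fst snd] in B. change (f ((n + k)%nat, s (n + k)%nat)) with
        (s (Datatypes.S (n + k))) in B.
      assert (tri := norm_minus_triangle (fst (s (Datatypes.S (n + k))))
        (fst (s (n + k)%nat)) (fst (s n))). lra. }
  assert (small : forall n, snd (s n) <= (1 / 2) ^ n).
  { induction n as [| n IH]; [simpl; lra |].
    destruct (hf (n, s n) (pos _)) as [B _]. cbn [fst snd] in B.
    change (f (n, s n)) with (s (Datatypes.S n)) in B. simpl pow. lra. }
  destruct (cauchy_sequence_converges (fun n => fst (s n))) as [y hy].
  { intros e he.
    destruct (pow_lt_1_zero (1 / 2)) with (y := e / 2) as [N hN];
      [rewrite Rabs_pos_eq; lra | lra |].
    exists N. intros n m hn hm.
    assert (a := nested N (n - N)%nat). assert (b := nested N (m - N)%nat).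
    replace (N + (n - N))%nat with n in a by lia.
    replace (N + (m - N))%nat with m in b by lia.
    assert (tri := norm_minus_triangle (fst (s n)) (fst (s N)) (fst (s m))).
    rewrite (norm_minus_comm (fst (s N))) in tri.
    assert (q := hN N (le_n N)). apply Rabs_def2 in q.
    assert (pn := pos n). assert (pm := pos m). assert (sN := small N). lra. }
  assert (inside : forall n, norm (minus y (fst (s n))) <= snd (s n)).
  { intros n. apply le_epsilon. intros e he. destruct (hy e he) as [N hN].
    assert (a := nested n N). assert (b := hN (n + N)%nat ltac:(lia)).
    assert (tri := norm_minus_triangle y (fst (s (n + N)%nat)) (fst (s n))).
    rewrite norm_minus_comm in b. assert (p := pos (n + N)%nat). lra. }
  destruct (semigroup_right_continuous y 1 Rlt_0_1) as [d [hd B]].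
  destruct (INR_archimed 1 (norm y + 1 + / d)) as [n hn]; [lra |].
  rewrite Rmult_1_r in hn.
  assert (hd' : 0 < / d) by now apply Rinv_0_lt_compat.
  assert (py := norm_nonneg y).
  destruct (hf (n, s n) (pos n)) as [_ [_ [t [ht big]]]]. cbn [fst snd] in *.
  assert (td : / (INR n + 1) < d).
  { rewrite <- (Rinv_inv d). apply Rinv_lt_contravar; [| lra].
    apply Rmult_lt_0_compat; lra. }
  specialize (big y (inside (Datatypes.S n))).
  assert (Bt := B t ltac:(lra)).
  assert (tri := norm_le_minus (S t y) y). lra.
Qed.

Lemma semigroup_locally_bounded b :
  exists c, 0 < c /\ forall t x, 0 <= t <= b -> norm (S t x) <= c * norm x.
Proof.
  destruct semigroup_bounded_near_0 as [d [c [hd [hc B]]]].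
  assert (iter : forall n : nat, exists c, 0 < c /\
    forall t x, 0 <= t <= INR n * d -> norm (S t x) <= c * norm x).
  { induction n as [| n [k [hk IH]]].
    - exists 1. split; [lra |]. simpl. intros t x ht.
      replace t with 0 by lra. rewrite semigroup_0. lra.
    - exists (k * c + k). split; [nra |]. rewrite S_INR. intros t x ht.
      assert (hn := pos_INR n). assert (px := norm_nonneg x).
      assert (0 <= k * norm x) by (apply Rmult_le_pos; lra).
      assert (0 <= k * c * norm x) by (repeat apply Rmult_le_pos; lra).
      destruct (Rle_or_lt t (INR n * d)) as [le | lt].
      + apply Rle_trans with (k * norm x); [apply IH; lra | lra].
      + assert (0 <= INR n * d) by (apply Rmult_le_pos; lra).
        replace t with (INR n * d + (t - INR n * d)) by ring.
        rewrite semigroup_plus by lra.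
        apply Rle_trans with (k * (c * norm x)); [| lra].
        apply Rle_trans with (k * norm (S (t - INR n * d) x)).
        * apply IH. lra.
        * apply Rmult_le_compat_l; [lra |]. apply B. lra. }
  destruct (INR_archimed d b hd) as [n hn].
  destruct (iter n) as [k [hk IH]]. exists k. split; [easy |].
  intros t x ht. apply IH. lra.
Qed.

Lemma semigroup_continuous x :
  continuous_on (fun t => 0 <= t) (fun t : R => S t x).
Proof.
  apply continuous_on_half_line. intros t ht e he.
  destruct (semigroup_locally_bounded (t + 1)) as [c [hc B]].
  destruct (semigroup_right_continuous x (e / c)) as [d [hd Bd]];
    [now apply Rdiv_lt_0_compat |].
  exists (Rmin d 1). split; [apply Rmin_glb_lt; lra |].
  assert (key : forall r s, 0 <= r <= s -> s <= t + 1 -> s - r < d ->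
    norm (minus (S s x) (S r x)) <= e).
  { intros r s hr hs rs.
    replace s with (r + (s - r)) by ring.
    rewrite semigroup_plus by lra.
    rewrite <- (lin_minus _ (semigroup_linear r (proj1 hr))).
    apply Rle_trans with (c * norm (minus (S (s - r) x) x)).
    { apply B. lra. }
    apply Rle_trans with (c * (e / c)); [| right; field; lra].
    apply Rmult_le_compat_l; [lra |]. apply Bd. lra. }
  assert (l := Rmin_l d 1). assert (l' := Rmin_r d 1).
  intros s hs st. apply Rabs_def2 in st.
  destruct (Rle_or_lt t s).
  - apply key; lra.
  - rewrite norm_minus_comm. apply key; lra.
Qed.

(** * Generators *)

Section Generator.
Context (A : linear_operator H H) (hA : opp_is_generator S A).

Lemma generator_little_o x :
  dom A x -> little_o (fun h => minus (minus (S h x) x) (scal h (opp (A x)))).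
Proof.
  intros hx. apply filterlim_quotient. now apply hA.
Qed.

Lemma dom_of_little_o x y :
  little_o (fun h => minus (minus (S h x) x) (scal h y)) ->
  dom A x /\ opp (A x) = y.
Proof.
  intros o. apply hA.
  now apply (filterlim_quotient (fun h => minus (S h x) x)).
Qed.

Lemma dom_semigroup t x :
  0 <= t -> dom A x -> dom A (S t x) /\ A (S t x) = S t (A x).
Proof.
  intros ht hx. assert (lin := semigroup_linear t ht).
  destruct (dom_of_little_o (S t x) (S t (opp (A x)))) as [d E].
  - eapply little_o_ext;
      [| exact (little_o_linear _ _ lin (generator_little_o x hx))].
    intros h h0. cbv beta.
    rewrite !(lin_minus _ lin), (lin_scal _ lin).
    rewrite <- !semigroup_plus by lra. now rewrite (Rplus_comm t).
  - split; [easy |].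
    assert (E' : opp (opp (A (S t x))) = opp (opp (S t (A x)))).
    { rewrite E, (lin_opp _ lin). reflexivity. }
    etransitivity; [| etransitivity; [exact E' |]]; vec.
Qed.

Lemma semigroup_derivative t x :
  0 <= t -> dom A x ->
  little_o (fun h =>
    minus (minus (S (t + h) x) (S t x)) (scal h (opp (A (S t x))))).
Proof.
  intros ht hx. destruct (dom_semigroup t x ht hx) as [d _].
  eapply little_o_ext; [| exact (generator_little_o _ d)].
  intros h h0. cbv beta. now rewrite Rplus_comm, semigroup_plus by lra.
Qed.

(** The averages of an orbit over short times approximate its origin, and they
    belong to the domain: [S k] shifts the interval of integration, so the
    increment of the integral consists of two integrals over intervals of
    length [k]. *)
Lemma dom_dense x e : 0 < e -> exists y, dom A y /\ norm (minus y x) <= e.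
Proof.
  intros he.
  pose (I := fun a b => RInt (fun t => S t x) a b).
  assert (hI : forall a b, 0 <= a <= b -> is_RInt (fun t => S t x) a b (I a b)).
  { intros a b hab. apply RInt_correct. apply ex_RInt_half_line; [| easy].
    apply semigroup_continuous. }
  assert (hd : forall h, 0 < h -> dom A (I 0 h)).
  { intros h hh.
    apply (dom_of_little_o _ (minus (S h x) x)).
    assert (o1 : little_o (fun k => minus (I h (h + k)) (scal k (S h x)))).
    { apply (little_o_RInt (fun t => S t x) h);
        [apply semigroup_continuous | lra |].
      intros k hk. apply hI. lra. }
    assert (o2 : little_o (fun k => minus (I 0 (0 + k)) (scal k (S 0 x)))).
    { apply (little_o_RInt (fun t => S t x) 0);
        [apply semigroup_continuous | lra |].
      intros k hk. apply hI. lra. }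
    eapply little_o_ext;
      [| exact (little_o_plus _ _ o1 (little_o_opp _ o2))].
    intros k hk. cbv beta. rewrite Rplus_0_l, semigroup_0.
    assert (E : S k (I 0 h) = I k (h + k)).
    { assert (J : is_RInt (fun t => S (t + k) x) 0 h (I k (h + k))).
      { assert (J := is_RInt_comp_lin (fun t => S t x) 1 k 0 h (I k (h + k))).
        rewrite !Rmult_1_l, Rplus_0_l in J.
        specialize (J (hI k (h + k) ltac:(lra))).
        eapply is_RInt_ext; [| exact J].
        intros t _. cbv beta. rewrite Rmult_1_l. vec. }
      assert (J' : is_RInt (fun t => S (t + k) x) 0 h (S k (I 0 h))).
      { eapply is_RInt_ext;
          [| exact (is_RInt_linear (S k) _ 0 h _ (semigroup_linear k ltac:(lra))
                      (hI 0 h ltac:(lra)))].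
        intros t ht. rewrite Rmin_left, Rmax_right in ht by lra. cbv beta.
        rewrite Rplus_comm. now rewrite semigroup_plus by lra. }
      rewrite <- (is_RInt_unique _ _ _ _ J). symmetry.
      exact (is_RInt_unique _ _ _ _ J'). }
    rewrite E.
    assert (C1 : plus (I 0 k) (I k (h + k)) = I 0 (h + k)).
    { apply (RInt_Chasles (fun t => S t x)); eexists; apply hI; lra. }
    assert (C2 : plus (I 0 h) (I h (h + k)) = I 0 (h + k)).
    { apply (RInt_Chasles (fun t => S t x)); eexists; apply hI; lra. }
    assert (E1 : I k (h + k) = minus (plus (I 0 h) (I h (h + k))) (I 0 k)).
    { rewrite C2, <- C1. vec. }
    rewrite E1. vec. }
  destruct (semigroup_right_continuous x e he) as [d [d0 B]].
  exists (scal (/ (d / 2)) (I 0 (d / 2))). split.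
  { apply dom_scal. apply hd. lra. }
  assert (M : norm (minus (I 0 (d / 2)) (scal (d / 2 - 0) x))
              <= e * (d / 2 - 0)).
  { apply (is_RInt_near_constant (fun t => S t x)); [lra | apply hI; lra |].
    intros t ht. apply B. lra. }
  apply Rle_trans with
    (norm (scal (/ (d / 2)) (minus (I 0 (d / 2)) (scal (d / 2 - 0) x)))).
  { right. f_equal. vec. field. lra. }
  assert (pd : 0 < / (d / 2)) by (apply Rinv_0_lt_compat; lra).
  rewrite norm_scal_H, Rabs_pos_eq by lra.
  apply Rle_trans with (/ (d / 2) * (e * (d / 2 - 0))).
  - apply Rmult_le_compat_l; [lra | exact M].
  - right. field. lra.
Qed.

Lemma inverse_semigroup (Ainv : H -> H) t x :
  is_bounded_inverse A Ainv -> 0 <= t -> Ainv (S t x) = S t (Ainv x).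
Proof.
  intros [_ [R L]] ht. destruct (R x) as [d E].
  destruct (dom_semigroup t (Ainv x) ht d) as [d' E'].
  rewrite <- (L _ d'), E', E. reflexivity.
Qed.

End Generator.
End Semigroup.

(** * Energy estimates *)

(** The right derivative of a squared norm, when [p] follows [q] up to
    [h * g + o (h)]. Here [q] is only continuous at [0]; it stands for an orbit
    of the semigroup, whose own increment [semigroup_energy] controls. *)
Lemma inner_sq_little_o {H : Hilbert} (p q : R -> H) (x g : H) (e : R) :
  0 < e ->
  little_o (fun h => minus (minus (p h) (q h)) (scal h g)) ->
  (forall e, 0 < e -> exists d, 0 < d /\
     forall h, 0 <= h < d -> norm (minus (q h) x) <= e) ->
  exists d, 0 < d /\ forall h, 0 < h < d ->
    inner (p h) (p h) <= inner (q h) (q h) + h * (2 * inner g x + e).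
Proof.
  intros he o lim.
  assert (pg := norm_nonneg g). assert (px := norm_nonneg x).
  pose (a := norm g + norm x + 1).
  pose (e1 := Rmin 1 (e / 4 / a)).
  assert (he1 : 0 < e1).
  { apply Rmin_glb_lt; [lra |]. apply Rdiv_lt_0_compat; unfold a; lra. }
  assert (e1_le_1 : e1 <= 1) by apply Rmin_l.
  assert (e1_a : e1 * a <= e / 4).
  { apply Rle_trans with (e / 4 / a * a).
    - apply Rmult_le_compat_r; [unfold a; lra | apply Rmin_r].
    - right. field. unfold a. lra. }
  destruct (o e1 he1) as [d1 [hd1 B1]].
  destruct (lim e1 he1) as [d2 [hd2 B2]].
  pose (b := (norm g + 1) * (norm g + 1)).
  assert (hb : 0 < b) by (unfold b; apply Rmult_lt_0_compat; lra).
  exists (Rmin (Rmin d1 d2) (e / 2 / b)).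
  split.
  { repeat apply Rmin_glb_lt; try easy. apply Rdiv_lt_0_compat; lra. }
  intros h hh.
  assert (l := Rmin_l (Rmin d1 d2) (e / 2 / b)).
  assert (l' := Rmin_r (Rmin d1 d2) (e / 2 / b)).
  assert (l1 := Rmin_l d1 d2). assert (l2 := Rmin_r d1 d2).
  specialize (B1 h ltac:(lra)). specialize (B2 h ltac:(lra)).
  set (r := minus (minus (p h) (q h)) (scal h g)) in *.
  assert (E : inner (p h) (p h) = inner (q h) (q h) + 2 * h * inner g x
    + 2 * h * inner g (minus (q h) x) + 2 * inner r (q h)
    + inner (plus (scal h g) r) (plus (scal h g) r)).
  { unfold r. repeat inner_expand.
    rewrite (inner_sym _ (q h) (p h)), (inner_sym _ g (p h)),
      (inner_sym _ g (q h)). ring. }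
  assert (C1 := cauchy_schwarz g (minus (q h) x)).
  assert (C2 := cauchy_schwarz r (q h)).
  assert (pr := norm_nonneg r). assert (pq := norm_nonneg (q h)).
  assert (Nq := norm_le_minus (q h) x).
  assert (pm := norm_nonneg (minus (q h) x)).
  assert (D1 : inner g (minus (q h) x) <= norm g * e1).
  { apply Rle_trans with (1 := C1). now apply Rmult_le_compat_l. }
  assert (D2 : inner r (q h) <= e1 * h * (norm x + 1)).
  { apply Rle_trans with (1 := C2). apply Rmult_le_compat; lra. }
  assert (D3 : norm (plus (scal h g) r) <= h * (norm g + 1)).
  { apply Rle_trans with (1 := norm_plus_le _ _).
    rewrite norm_scal_H, Rabs_pos_eq by lra. nra. }
  assert (D4 : inner (plus (scal h g) r) (plus (scal h g) r) <= h * (e / 2)).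
  { rewrite inner_self.
    apply Rle_trans with (h * (norm g + 1) * (h * (norm g + 1))).
    - apply Rmult_le_compat; try apply norm_nonneg; exact D3.
    - replace (h * (norm g + 1) * (h * (norm g + 1))) with (h * (h * b))
        by (unfold b; ring).
      apply Rmult_le_compat_l; [lra |].
      apply Rle_trans with (e / 2 / b * b); [| right; field; lra].
      apply Rmult_le_compat_r; lra. }
  rewrite E.
  assert (D5 : h * inner g (minus (q h) x) <= h * (norm g * e1))
    by (apply Rmult_le_compat_l; lra).
  assert (D6 : h * (e1 * a) <= h * (e / 4)) by (apply Rmult_le_compat_l; lra).
  unfold a in D6. lra.
Qed.

Section Evolution.
Context {H : Hilbert} (S : R -> H -> H) (hS : is_C0_semigroup S)
  (A : linear_operator H H) (hA : opp_is_generator S A)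
  (alpha : R) (alpha_pos : 0 < alpha).

Definition coercive (B : H -> H) : Prop :=
  is_linear B /\
  forall x, dom A x -> inner (plus (A x) (B x)) x >= alpha * norm x ^ 2.

(** On the domain this is the energy identity and coercivity; it survives the
    passage to the closure because [A] has disappeared from the right-hand
    side. *)
Lemma semigroup_energy (B : H -> H) (x : H) (e : R) :
  coercive B -> 0 < e ->
  exists d, 0 < d /\ forall h, 0 < h < d ->
    inner (S h x) (S h x) <=
      inner x x + h * (2 * (inner (B x) x - alpha * inner x x) + e).
Proof.
  intros [Blin hB] he.
  pose (k := fun y => 2 * (inner (B y) y - alpha * inner y y)).
  assert (px := norm_nonneg x).
  destruct (lin_bound B Blin) as [cB [hcB BB]].
  pose (m := (cB + alpha) * (2 * norm x + 1)).
  assert (hm : 0 < m) by (unfold m; apply Rmult_lt_0_compat; lra).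
  pose (r := Rmin 1 (e / 4 / m)).
  assert (hr : 0 < r).
  { apply Rmin_glb_lt; [lra |]. apply Rdiv_lt_0_compat; lra. }
  assert (r1 : r <= 1) by apply Rmin_l.
  assert (rm : r * m <= e / 4).
  { apply Rle_trans with (e / 4 / m * m).
    - apply Rmult_le_compat_r; [lra | apply Rmin_r].
    - right. field. lra. }
  assert (kc : forall y, norm (minus y x) <= r -> k y <= k x + e / 2).
  { intros y hy.
    assert (E : k y - k x = 2 * (inner (B (minus y x)) y
      + inner (B x) (minus y x) + alpha * inner (minus x y) (plus x y))).
    { unfold k. rewrite (lin_minus B Blin). repeat inner_expand.
      rewrite (inner_sym _ y x). ring. }
    assert (Ny := norm_le_minus y x). assert (py := norm_nonneg y).
    assert (pm := norm_nonneg (minus y x)).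
    assert (C1 : inner (B (minus y x)) y <= cB * r * (norm x + 1)).
    { apply Rle_trans with (1 := cauchy_schwarz _ _).
      apply Rmult_le_compat; try apply norm_nonneg; [| lra].
      apply Rle_trans with (1 := BB _). apply Rmult_le_compat_l; lra. }
    assert (C2 : inner (B x) (minus y x) <= cB * norm x * r).
    { apply Rle_trans with (1 := cauchy_schwarz _ _).
      apply Rmult_le_compat; try apply norm_nonneg; [apply BB | lra]. }
    assert (C3 : inner (minus x y) (plus x y) <= r * (2 * norm x + 1)).
    { apply Rle_trans with (1 := cauchy_schwarz _ _).
      apply Rmult_le_compat; try apply norm_nonneg.
      - now rewrite norm_minus_comm.
      - apply Rle_trans with (1 := norm_plus_le _ _). lra. }
    assert (C4 : alpha * inner (minus x y) (plus x y)
                 <= alpha * (r * (2 * norm x + 1)))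
      by (apply Rmult_le_compat_l; lra).
    unfold m in rm. lra. }
  destruct (semigroup_locally_bounded S hS 1) as [cS [hcS BS]].
  destruct (semigroup_right_continuous S hS x (r / 2)) as [d [hd Bd]]; [lra |].
  exists (Rmin d 1). split; [apply Rmin_glb_lt; lra |].
  assert (l := Rmin_l d 1). assert (l' := Rmin_r d 1).
  intros h hh.
  (* near [x], on the domain, the squared norm grows at most at the rate
     [k x + e] up to the time [h] *)
  assert (on_dom : forall y, dom A y -> cS * norm (minus y x) <= r / 2 ->
    inner (S h y) (S h y) <= inner y y + h * (k x + e)).
  { intros y hy near.
    assert (P : 0 <= inner y y + h * (k x + e) - inner (S h y) (S h y));
      [| lra].
    apply (nonneg_of_contact
      (fun s => inner y y + s * (k x + e) - inner (S s y) (S s y))).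
    - intros t ht e1 he1.
      pose (n := 2 * norm (S t y) + 1).
      assert (pn := norm_nonneg (S t y)).
      pose (q := Rabs (k x + e) + 1).
      assert (hq : 0 < q) by (unfold q; assert (z := Rabs_pos (k x + e)); lra).
      destruct (proj1 (continuous_on_half_line _) (semigroup_continuous S hS y)
        t (proj1 ht) (Rmin 1 (e1 / 2 / n))) as [d1 [hd1 B1]].
      { apply Rmin_glb_lt; [lra |]. apply Rdiv_lt_0_compat; unfold n; lra. }
      exists (Rmin d1 (e1 / 2 / q)). split.
      { apply Rmin_glb_lt; [easy |]. apply Rdiv_lt_0_compat; lra. }
      intros s hs st.
      assert (m1 := Rmin_l d1 (e1 / 2 / q)).
      assert (m2 := Rmin_r d1 (e1 / 2 / q)).
      specialize (B1 s hs ltac:(lra)).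
      assert (n1 := Rmin_l 1 (e1 / 2 / n)).
      assert (n2 := Rmin_r 1 (e1 / 2 / n)).
      assert (F1 : Rabs ((s - t) * (k x + e)) <= e1 / 2).
      { rewrite Rabs_mult. apply Rle_trans with (e1 / 2 / q * q).
        - apply Rmult_le_compat; try apply Rabs_pos; [lra | unfold q; lra].
        - right. field. lra. }
      assert (F2 : Rabs (norm (S s y) * norm (S s y)
                         - norm (S t y) * norm (S t y)) <= e1 / 2).
      { replace (norm (S s y) * norm (S s y) - norm (S t y) * norm (S t y))
          with ((norm (S s y) - norm (S t y)) * (norm (S s y) + norm (S t y)))
          by ring.
        assert (ps := norm_nonneg (S s y)).
        assert (tri := norm_le_minus (S s y) (S t y)).
        rewrite Rabs_mult. apply Rle_trans with (e1 / 2 / n * n).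
        - apply Rmult_le_compat; try apply Rabs_pos.
          + apply Rle_trans with (1 := Rabs_norm_minus _ _). lra.
          + rewrite Rabs_pos_eq by lra. unfold n. lra.
        - right. field. unfold n. lra. }
      rewrite !inner_self.
      apply Rabs_le_between in F1. apply Rabs_le_between in F2.
      apply Rabs_le. lra.
    - lra.
    - rewrite semigroup_0 by easy. lra.
    - intros t ht E.
      destruct (dom_semigroup S hS A hA t y (proj1 ht) hy) as [hty _].
      destruct (inner_sq_little_o (fun h => S (t + h) y) (fun _ => S t y)
        (S t y) (opp (A (S t y))) (e / 2)) as [d1 [hd1 B1]].
      + lra.
      + now apply semigroup_derivative.
      + intros c hc. exists 1. split; [lra |]. intros s _.
        rewrite norm_minus_diag. lra.
      + exists d1. split; [easy |]. intros s hs. specialize (B1 s hs).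
        cbv beta in B1.
        assert (near' : norm (minus (S t y) x) <= r).
        { assert (tri := norm_minus_triangle (S t y) (S t x) x).
          assert (b1 := Bd t ltac:(lra)).
          assert (b2 := BS t (minus y x) ltac:(lra)).
          rewrite (lin_minus _ (semigroup_linear S hS t (proj1 ht))) in b2.
          lra. }
        assert (K := kc _ near').
        assert (Co := hB _ hty).
        assert (E2 : norm (S t y) ^ 2 = inner (S t y) (S t y))
          by (symmetry; apply inner_norm).
        rewrite E2 in Co.
        assert (E1 : inner (opp (A (S t y))) (S t y) <= k (S t y) / 2).
        { unfold k. rewrite inner_plus_l in Co. inner_expand. lra. }
        assert (E3 : s * (2 * inner (opp (A (S t y))) (S t y) + e / 2)
                     <= s * (k x + e)) by (apply Rmult_le_compat_l; lra).
        lra. }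
  (* with [h] fixed, both sides are continuous in the initial value *)
  apply le_epsilon. intros c hc.
  change (2 * (inner (B x) x - alpha * inner x x)) with (k x).
  set (a := S h x). assert (pa := norm_nonneg a).
  pose (w := 2 * cS * norm a + 2 * norm x + 1).
  assert (hw : 0 < w).
  { unfold w. assert (0 <= 2 * cS * norm a) by (apply Rmult_le_pos; lra). lra. }
  pose (n := Rmin (Rmin 1 (c / w)) (r / 2 / cS)).
  assert (hn : 0 < n).
  { repeat apply Rmin_glb_lt; [lra | |]; apply Rdiv_lt_0_compat; lra. }
  assert (n1 := Rmin_l (Rmin 1 (c / w)) (r / 2 / cS)).
  assert (n2 := Rmin_r (Rmin 1 (c / w)) (r / 2 / cS)).
  assert (n3 := Rmin_l 1 (c / w)). assert (n4 := Rmin_r 1 (c / w)).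
  fold n in n1, n2.
  destruct (dom_dense S hS A hA x n hn) as [y [hy xy]].
  assert (N1 : cS * norm (minus y x) <= r / 2).
  { apply Rle_trans with (cS * (r / 2 / cS)); [| right; field; lra].
    apply Rmult_le_compat_l; lra. }
  specialize (on_dom y hy N1).
  assert (N2 : norm (minus a (S h y)) <= cS * n).
  { unfold a. rewrite <- (lin_minus _ (semigroup_linear S hS h ltac:(lra))).
    apply Rle_trans with (cS * norm (minus x y)).
    - apply BS. lra.
    - rewrite norm_minus_comm. apply Rmult_le_compat_l; [lra | exact xy]. }
  assert (E1 : inner a a = inner (S h y) (S h y) + 2 * inner (minus a (S h y)) a
    - inner (minus a (S h y)) (minus a (S h y))).
  { repeat inner_expand. rewrite (inner_sym _ a (S h y)). ring. }
  assert (E2 : inner y y = inner x x + 2 * inner (minus y x) x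
    + inner (minus y x) (minus y x)).
  { repeat inner_expand. rewrite (inner_sym _ x y). ring. }
  rewrite inner_self with (x := minus a (S h y)) in E1.
  rewrite inner_self with (x := minus y x) in E2.
  assert (pxy := norm_nonneg (minus y x)).
  assert (F1 : inner (minus a (S h y)) a <= cS * n * norm a).
  { apply Rle_trans with (1 := cauchy_schwarz _ _).
    apply Rmult_le_compat_r; lra. }
  assert (F2 : inner (minus y x) x <= n * norm x).
  { apply Rle_trans with (1 := cauchy_schwarz _ _).
    apply Rmult_le_compat_r; lra. }
  assert (F3 : norm (minus y x) * norm (minus y x) <= n * 1)
    by (apply Rmult_le_compat; lra).
  assert (F4 : n * w <= c).
  { apply Rle_trans with (c / w * w); [| right; field; lra].
    apply Rmult_le_compat_r; lra. }
  unfold w in F4.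
  assert (F5 := Rle_0_sqr (norm (minus a (S h y)))). unfold Rsqr in F5.
  lra.
Qed.

(** The local form of the mild equation [w' = - A w + g]. It makes sense for
    values outside the domain and is stable under differences and time
    shifts. *)
Definition evolves (g w : R -> H) : Prop :=
  continuous_on (fun t => 0 <= t) w /\
  forall t, 0 <= t ->
    little_o (fun h => minus (minus (w (t + h)) (S h (w t))) (scal h (g t))).

Lemma evolves_minus g1 w1 g2 w2 :
  evolves g1 w1 -> evolves g2 w2 ->
  evolves (fun t => minus (g1 t) (g2 t)) (fun t => minus (w1 t) (w2 t)).
Proof.
  intros [c1 o1] [c2 o2]. split.
  - now apply continuous_on_minus.
  - intros t ht.
    eapply little_o_ext;
      [| exact (little_o_plus _ _ (o1 t ht) (little_o_opp _ (o2 t ht)))].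
    intros h h0. cbv beta.
    rewrite (lin_minus _ (semigroup_linear S hS h ltac:(lra))). vec.
Qed.

Lemma evolves_scal g w (k : R) :
  evolves g w -> evolves (fun t => scal k (g t)) (fun t => scal k (w t)).
Proof.
  intros [c o].
  assert (lin : is_linear (fun x : H => scal k x)).
  { split.
    - intros x y. vec.
    - intros c' x. vec.
    - exists (Rabs k + 1). assert (p := Rabs_pos k). split; [lra |].
      intros x. rewrite norm_scal_H. assert (q := norm_nonneg x). nra. }
  split.
  - apply (continuous_on_comp (fun x : H => scal k x)); [| exact c].
    intros x. exact (linear_cont (fun x : H => scal k x) x lin).
  - intros t ht.
    eapply little_o_ext; [| exact (little_o_linear _ _ lin (o t ht))].
    intros h h0. cbv beta.
    rewrite (lin_scal _ (semigroup_linear S hS h ltac:(lra))). vec.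
Qed.

Lemma evolves_shift g w s :
  0 <= s -> evolves g w ->
  evolves (fun t => g (t + s)) (fun t => w (t + s)).
Proof.
  intros hs [c o]. split.
  - apply continuous_on_half_line. intros t ht e he.
    destruct (proj1 (continuous_on_half_line w) c (t + s) ltac:(lra) e he)
      as [d [hd B]].
    exists d. split; [easy |]. intros t' ht' near.
    apply B; [lra |]. now replace (t' + s - (t + s)) with (t' - t) by ring.
  - intros t ht. eapply little_o_ext; [| exact (o (t + s) ltac:(lra))].
    intros h h0. cbv beta. now replace (t + h + s) with (t + s + h) by ring.
Qed.

(** The comparison function solves [y' = - alpha y + rho exp (- alpha t) ^ 2]
    up to a positive constant, which makes the comparison strict where the
    two sides meet, and keeps the norm away from [0] there. *)
Lemma energy_estimate g w rho :
  evolves g w -> 0 <= rho ->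
  (forall t, 0 <= t -> exists B, coercive B /\
     inner (plus (g t) (B (w t))) (w t)
       <= rho * exp (- alpha * t) ^ 2 * norm (w t)) ->
  forall t, 0 <= t ->
    norm (w t) <= (norm (w 0) + rho / alpha) * exp (- alpha * t).
Proof.
  intros [cw ow] hrho hB b hb.
  assert (pw := norm_nonneg (w 0)).
  assert (hra : 0 <= rho / alpha) by (apply Rle_mult_inv_pos; lra).
  apply le_epsilon. intros delta hdelta.
  pose (E := fun t => exp (- alpha * t)).
  pose (psi := fun t => E t * (norm (w 0) + rho / alpha * (1 - E t)) + delta).
  assert (Ebnd : forall t, 0 <= t -> 0 < E t <= 1)
    by (intros t ht; now apply exp_decay_le).
  assert (psi' : forall t,
    derivable_pt_lim psi t
      (- alpha * (psi t - delta) + rho * E t ^ 2)).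
  { intros t. apply is_derive_Reals. unfold psi, E.
    auto_derive; [easy |]. field. lra. }
  apply Rle_trans with (psi b).
  2:{ unfold psi. assert (e := Ebnd b hb). fold (E b).
      assert (0 <= rho / alpha * E b * E b)
        by (do 2 (apply Rmult_le_pos; [| lra]); lra).
      lra. }
  assert (P : 0 <= psi b - norm (w b)); [| lra].
  apply (nonneg_of_contact (fun t => psi t - norm (w t))); [| easy | |].
  - intros t ht e he.
    destruct (proj1 (continuous_on_half_line w) cw t (proj1 ht) (e / 2))
      as [d1 [hd1 B1]]; [lra |].
    assert (cpsi : continuity_pt psi t).
    { apply derivable_continuous_pt. exists (- alpha * (psi t - delta)
        + rho * E t ^ 2). apply psi'. }
    destruct (cpsi (e / 2)) as [d2 [hd2 B2]]; [lra |].
    exists (Rmin d1 d2). split; [now apply Rmin_glb_lt |].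
    intros s hs st.
    assert (l1 := Rmin_l d1 d2). assert (l2 := Rmin_r d1 d2).
    specialize (B1 s hs ltac:(lra)).
    assert (C1 := Rabs_norm_minus (w s) (w t)).
    assert (C2 : Rabs (psi s - psi t) <= e / 2).
    { destruct (Req_dec s t) as [-> | ne].
      - rewrite Rminus_diag, Rabs_R0. lra.
      - left. apply B2. split.
        + split; [exact I | auto].
        + apply Rlt_le_trans with (1 := st) (2 := l2). }
    apply Rabs_le_between in C1. apply Rabs_le_between in C2.
    apply Rabs_le. lra.
  - unfold psi, E. rewrite Rmult_0_r, exp_0. lra.
  - intros t ht contact.
    destruct (hB t (proj1 ht)) as [B [coB le]].
    set (x := w t) in *. set (n := norm x) in *.
    assert (e := Ebnd t (proj1 ht)).
    assert (psi_n : psi t = n) by lra.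
    assert (hn : delta <= n).
    { rewrite <- psi_n. unfold psi.
      assert (0 <= rho / alpha * (1 - E t)) by (apply Rmult_le_pos; lra).
      assert (0 <= E t * (norm (w 0) + rho / alpha * (1 - E t)))
        by (apply Rmult_le_pos; lra). lra. }
    assert (had : 0 < alpha * delta) by now apply Rmult_lt_0_compat.
    (* the margin [alpha * delta] of the comparison function absorbs the
       errors [e1] of the two expansions below and that of [psi] *)
    pose (e1 := n * (alpha * delta) / 2).
    assert (he1 : 0 < e1).
    { assert (0 < n * (alpha * delta)) by (apply Rmult_lt_0_compat; lra).
      unfold e1. lra. }
    destruct (semigroup_energy B x e1 coB he1) as [d1 [hd1 B1]].
    destruct (inner_sq_little_o (fun h => w (t + h)) (fun h => S h x) x (g t)
      e1) as [d2 [hd2 B2]]; [easy | exact (ow t (proj1 ht)) | |].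
    { intros c hc. now apply semigroup_right_continuous. }
    destruct (psi' t (alpha * delta / 2)) as [d3 B3]; [lra |].
    rewrite psi_n in B3.
    pose (m := - alpha * (n - delta) + rho * E t ^ 2 - alpha * delta / 2).
    pose (d4 := n / (Rabs m + 1)).
    assert (pm := Rabs_pos m).
    assert (hd4 : 0 < d4) by (apply Rdiv_lt_0_compat; lra).
    exists (Rmin (Rmin d1 d2) (Rmin d3 d4)). split.
    { repeat apply Rmin_glb_lt; try easy. apply cond_pos. }
    intros h hh.
    assert (l1 := Rmin_l (Rmin d1 d2) (Rmin d3 d4)).
    assert (l2 := Rmin_r (Rmin d1 d2) (Rmin d3 d4)).
    assert (l3 := Rmin_l d1 d2). assert (l4 := Rmin_r d1 d2).
    assert (l5 := Rmin_l d3 d4). assert (l6 := Rmin_r d3 d4).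
    specialize (B1 h ltac:(lra)). specialize (B2 h ltac:(lra)).
    specialize (B3 h ltac:(lra) ltac:(rewrite Rabs_pos_eq; lra)).
    assert (psi_low : n + h * m <= psi (t + h)).
    { apply Rabs_def2 in B3.
      assert (Q : (psi (t + h) - n) = h * ((psi (t + h) - n) / h))
        by (field; lra).
      assert (Q' : h * m <= h * ((psi (t + h) - n) / h)).
      { apply Rmult_le_compat_l; [lra |]. unfold m. lra. }
      lra. }
    assert (low_pos : 0 <= n + h * m).
    { assert (hm : h * Rabs m <= n).
      { apply Rle_trans with (d4 * (Rabs m + 1)).
        - apply Rmult_le_compat; lra.
        - right. unfold d4. field. lra. }
      assert (q := Rle_abs (- m)). rewrite Rabs_Ropp in q.
      assert (h * - m <= h * Rabs m) by (apply Rmult_le_compat_l; lra). lra. }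
    assert (sq : norm (w (t + h)) <= n + h * m).
    { apply norm_le_of_sqr; [easy |].
      rewrite inner_plus_l in le. cbv beta in B2.
      assert (xx : inner x x = n * n) by apply inner_self.
      rewrite xx in B1.
      assert (hle : h * (2 * (inner (g t) x + inner (B x) x))
                    <= h * (2 * (rho * E t ^ 2 * n)))
        by (apply Rmult_le_compat_l; [lra |]; unfold E; lra).
      assert (sm := Rle_0_sqr (h * m)). unfold Rsqr in sm.
      assert (fin : n * n + h * (2 * (rho * E t ^ 2 * n) - 2 * alpha * (n * n)
        + 2 * e1) <= (n + h * m) * (n + h * m)).
      { replace ((n + h * m) * (n + h * m))
          with (n * n + 2 * n * h * m + h * m * (h * m)) by ring.
        unfold e1. unfold m at 1.
        replace (n * n + 2 * n * h *
          (- alpha * (n - delta) + rho * E t ^ 2 - alpha * delta / 2))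
          with (n * n + h * (2 * (rho * E t ^ 2 * n) - 2 * alpha * (n * n)
            + 2 * (n * (alpha * delta) / 2))) by field.
        lra. }
      lra. }
    lra.
Qed.

(** * Mild solutions *)

Lemma mild_initial F w0 u : is_mild_solution S F w0 u -> u 0 = w0.
Proof.
  intros [_ hu]. destruct (hu 0 (Rle_refl 0)) as [I [hI ->]].
  assert (Z : I = zero).
  { rewrite <- (is_RInt_unique _ _ _ _ hI).
    exact (is_RInt_unique _ _ _ _ (is_RInt_point _ 0)). }
  rewrite Z, semigroup_0 by easy. vec.
Qed.

(** [S h] carries the integral up to [t] into that for [t + h], so only the
    integral over a short interval remains in the increment. *)
Lemma mild_evolves F w0 u :
  (forall x, continuous F x) ->
  is_mild_solution S F w0 u -> evolves (fun t => opp (F (u t))) u.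
Proof.
  intros cF [cu hu]. split; [easy |].
  intros t ht e he.
  assert (cFu : continuous_on (fun t => 0 <= t) (fun t : R => F (u t))).
  { now apply continuous_on_comp. }
  destruct (semigroup_locally_bounded S hS 1) as [c [hc Bc]].
  destruct (proj1 (continuous_on_half_line _) cFu t ht (e / 2 / c))
    as [d1 [hd1 B1]]; [apply Rdiv_lt_0_compat; lra |].
  destruct (semigroup_right_continuous S hS (F (u t)) (e / 2))
    as [d2 [hd2 B2]]; [lra |].
  exists (Rmin 1 (Rmin d1 d2)). split.
  { repeat apply Rmin_glb_lt; lra. }
  intros h hh.
  assert (l1 := Rmin_l 1 (Rmin d1 d2)). assert (l2 := Rmin_r 1 (Rmin d1 d2)).
  assert (l3 := Rmin_l d1 d2). assert (l4 := Rmin_r d1 d2).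
  destruct (hu t ht) as [I1 [hI1 E1]].
  destruct (hu (t + h) ltac:(lra)) as [I2 [hI2 E2]].
  pose (f := fun s => S (t + h - s) (F (u s))).
  assert (lin := semigroup_linear S hS h ltac:(lra)).
  assert (J1 : is_RInt f 0 t (S h I1)).
  { eapply is_RInt_ext; [| exact (is_RInt_linear (S h) _ 0 t I1 lin hI1)].
    intros s hs. rewrite Rmin_left, Rmax_right in hs by lra. cbv beta. unfold f.
    replace (t + h - s) with (h + (t - s)) by ring.
    now rewrite semigroup_plus by (easy || lra). }
  destruct (ex_RInt_Chasles_2 f 0 t (t + h)) as [I3 J3];
    [lra | now exists I2 |].
  assert (E3 : I2 = plus (S h I1) I3).
  { rewrite <- (is_RInt_unique _ _ _ _ hI2).
    apply is_RInt_unique. exact (is_RInt_Chasles f 0 t (t + h) _ _ J1 J3). }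
  assert (N : norm (minus I3 (scal (t + h - t) (F (u t)))) <= e * (t + h - t)).
  { apply (is_RInt_near_constant f); [lra | easy |].
    intros s hs. unfold f.
    assert (lin' := semigroup_linear S hS (t + h - s) ltac:(lra)).
    apply Rle_trans with (1 := norm_minus_triangle _
      (S (t + h - s) (F (u t))) _).
    rewrite <- (lin_minus _ lin').
    assert (b1 := Bc (t + h - s) (minus (F (u s)) (F (u t))) ltac:(lra)).
    assert (b2 := B2 (t + h - s) ltac:(lra)).
    assert (b3 := B1 s ltac:(lra) ltac:(apply Rabs_def1; lra)).
    assert (b4 : c * norm (minus (F (u s)) (F (u t))) <= e / 2).
    { apply Rle_trans with (c * (e / 2 / c)); [| right; field; lra].
      apply Rmult_le_compat_l; [lra | exact b3]. }
    replace e with (e / 2 + e / 2) by field.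
    apply Rplus_le_compat; [exact (Rle_trans _ _ _ b1 b4) | exact b2]. }
  replace (t + h - t) with h in N by ring.
  apply Rle_trans with (2 := N). right.
  rewrite E1, E2, E3, (lin_minus _ lin), <- semigroup_plus by (easy || lra).
  rewrite (Rplus_comm h t).
  rewrite (norm_minus_comm I3). f_equal. vec.
Qed.

End Evolution.

(** * Differentiable maps between Hilbert spaces *)

Lemma filterdiff_norm {V W : Hilbert} (f : V -> W) (df : V -> W) (x : V) :
  filterdiff f (locally x) df <->
  is_linear df /\
  forall e, 0 < e -> exists d, 0 < d /\ forall y : V, norm (minus y x) < d ->
    norm (minus (minus (f y) (f x)) (df (minus y x))) <= e * norm (minus y x).
Proof.
  split; intros [lin D]; (split; [exact lin |]).
  - intros e he.
    assert (L := D x (fun P HP => HP) (mkposreal e he)).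
    destruct (locally_norm_le_locally x _ L) as [d B].
    exists d. split; [apply cond_pos |]. intros y hy. now apply B.
  - intros z hz.
    rewrite <- (is_filter_lim_locally_unique x z hz). intros e.
    destruct (D e (cond_pos e)) as [d [hd B]].
    apply (locally_le_locally_norm x).
    exists (mkposreal d hd). intros y hy. now apply B.
Qed.

Lemma le_of_le_small_multiple (a b c : R) :
  (forall e, 0 < e <= 1 -> a <= b + c * e) -> a <= b.
Proof.
  intros le. apply le_epsilon. intros e he.
  pose (k := Rmin 1 (e / (Rabs c + 1))).
  assert (pc := Rabs_pos c).
  assert (hk : 0 < k).
  { apply Rmin_glb_lt; [lra |]. apply Rdiv_lt_0_compat; lra. }
  assert (k1 : k <= 1) by apply Rmin_l.
  assert (k2 : k * (Rabs c + 1) <= e).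
  { apply Rle_trans with (e / (Rabs c + 1) * (Rabs c + 1)).
    - apply Rmult_le_compat_r; [lra | apply Rmin_r].
    - right. field. lra. }
  assert (q := Rle_abs c).
  assert (k * c <= k * Rabs c) by (apply Rmult_le_compat_l; lra).
  specialize (le k ltac:(lra)). lra.
Qed.

Section C1.
Context {H : Hilbert} (F : H -> H) (dF : H -> H -> H) (hF : is_C1 F dF).

Lemma differential_linear w : is_linear (dF w).
Proof. apply hF. Qed.

Lemma C1_continuous w : continuous F w.
Proof.
  apply (filterdiff_continuous F w). exists (dF w). apply hF.
Qed.

(** Against a fixed vector, the increment of [F] is that of a real function.
    The intermediate point depends on [y], which will be [a - b] or the
    remainder to be estimated. *)
Lemma inner_mean_value (a b y : H) :
  exists theta, 0 <= theta <= 1 /\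
    inner (minus (F a) (F b)) y
    = inner (dF (plus b (scal theta (minus a b))) (minus a b)) y.
Proof.
  pose (p := fun s : R => plus b (scal s (minus a b))).
  pose (d := fun s => inner (dF (p s) (minus a b)) y).
  assert (der : forall s,
    derivable_pt_lim (fun s => inner (F (p s)) y) s (d s)).
  { intros s e he.
    destruct (proj1 (filterdiff_norm F (dF (p s)) (p s)) (proj1 hF (p s)))
      as [lin D].
    assert (pab := norm_nonneg (minus a b)). assert (py := norm_nonneg y).
    pose (m := norm (minus a b) * norm y + 1).
    assert (hm : 0 < m).
    { unfold m. assert (0 <= norm (minus a b) * norm y)
        by (apply Rmult_le_pos; lra). lra. }
    destruct (D (e / 2 / m)) as [c [hc B]].
    { apply Rdiv_lt_0_compat; lra. }
    assert (hc' : 0 < c / (norm (minus a b) + 1))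
      by (apply Rdiv_lt_0_compat; lra).
    exists (mkposreal _ hc'). simpl. intros h nz hh.
    assert (E : minus (p (s + h)) (p s) = scal h (minus a b))
      by (unfold p; vec).
    specialize (B (p (s + h))). rewrite E, norm_scal_H in B.
    assert (ph := Rabs_pos_lt h nz).
    assert (near : Rabs h * norm (minus a b) < c).
    { apply Rle_lt_trans with (Rabs h * (norm (minus a b) + 1)).
      - apply Rmult_le_compat_l; lra.
      - apply Rlt_le_trans with (c / (norm (minus a b) + 1)
          * (norm (minus a b) + 1)).
        + apply Rmult_lt_compat_r; lra.
        + right. field. lra. }
    specialize (B near).
    set (r := minus (minus (F (p (s + h))) (F (p s)))
                (dF (p s) (scal h (minus a b)))) in B.
    replace ((inner (F (p (s + h))) y - inner (F (p s)) y) / h - d s)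
      with (inner r y / h).
    2:{ unfold r, d. rewrite (lin_scal _ lin). repeat inner_expand.
        field. exact nz. }
    assert (C : Rabs (inner r y) <= norm r * norm y).
    { apply Rabs_le. assert (C1 := cauchy_schwarz r y).
      assert (C2 := cauchy_schwarz (opp r) y).
      rewrite inner_opp_l, norm_opp_H in C2. lra. }
    unfold Rdiv. rewrite Rabs_mult, Rabs_inv.
    apply Rle_lt_trans with (e / 2); [| lra].
    apply Rle_trans with (e / 2 / m * (Rabs h * norm (minus a b)) * norm y
      * / Rabs h).
    - apply Rmult_le_compat_r; [left; now apply Rinv_0_lt_compat |].
      apply Rle_trans with (1 := C). now apply Rmult_le_compat_r.
    - apply Rle_trans with (e / 2 / m * m); [| right; field; lra].
      replace (e / 2 / m * (Rabs h * norm (minus a b)) * norm y * / Rabs h)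
        with (e / 2 / m * (norm (minus a b) * norm y)) by (field; lra).
      apply Rmult_le_compat_l; [| unfold m; lra].
      left. apply Rdiv_lt_0_compat; lra. }
  destruct (MVT_gen (fun s => inner (F (p s)) y) 0 1 d) as [s [hs E]].
  - intros x _. apply is_derive_Reals. apply der.
  - intros x _. apply derivable_continuous_pt. exists (d x). apply der.
  - rewrite Rmin_left, Rmax_right in hs by lra.
    exists s. split; [easy |].
    rewrite inner_minus_l. change (inner (dF (plus b (scal s (minus a b)))
      (minus a b)) y) with (d s).
    replace (p 1) with a in E by (unfold p; vec).
    replace (p 0) with b in E by (unfold p; vec).
    lra.
Qed.

Lemma norm_increment_le (a b : H) (f : H -> H) (c : R) :
  is_linear f -> 0 <= c ->
  (forall theta h, 0 <= theta <= 1 ->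
     norm (minus (dF (plus b (scal theta (minus a b))) h) (f h))
       <= c * norm h) ->
  norm (minus (minus (F a) (F b)) (f (minus a b))) <= c * norm (minus a b).
Proof.
  intros lin hc B. set (y := minus (minus (F a) (F b)) (f (minus a b))).
  apply norm_le_of_sqr; [apply Rmult_le_pos; [easy | apply norm_nonneg] |].
  destruct (inner_mean_value a b y) as [s [hs E]].
  assert (E1 : inner y y = inner (minus (dF (plus b (scal s (minus a b)))
    (minus a b)) (f (minus a b))) y).
  { unfold y at 1. rewrite !inner_minus_l, <- E, inner_minus_l. ring. }
  assert (C : norm y * norm y <= c * norm (minus a b) * norm y).
  { rewrite <- inner_self, E1. apply Rle_trans with (1 := cauchy_schwarz _ _).
    apply Rmult_le_compat_r; [apply norm_nonneg |]. now apply B. }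
  rewrite inner_self. assert (py := norm_nonneg y).
  assert (N : norm y <= c * norm (minus a b)).
  { destruct (Req_dec (norm y) 0) as [z | nz].
    - rewrite z. apply Rmult_le_pos; [easy | apply norm_nonneg].
    - apply Rmult_le_reg_r with (norm y); lra. }
  apply Rmult_le_compat; assumption.
Qed.

(** Uniform control of [dF] on a convex set. Balls give the local statements
    and the whole space the global one. *)
Record controlled (B : H -> Prop) (L D : R) : Prop := {
  ctl_L : 0 <= L;
  ctl_D : 0 <= D;
  ctl_convex : forall a b theta, B a -> B b -> 0 <= theta <= 1 ->
    B (plus b (scal theta (minus a b)));
  ctl_lipschitz : forall a b h, B a -> B b ->
    norm (minus (dF a h) (dF b h)) <= L * norm (minus a b) * norm h;
  ctl_bound : forall a h, B a -> norm (dF a h) <= D * norm h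
}.

Lemma taylor B L D a b :
  controlled B L D -> B a -> B b ->
  norm (minus (minus (F a) (F b)) (dF b (minus a b)))
    <= L * norm (minus a b) * norm (minus a b).
Proof.
  intros ctl ha hb. assert (hL := ctl_L _ _ _ ctl).
  assert (pab := norm_nonneg (minus a b)).
  apply norm_increment_le; [apply differential_linear | |].
  { now apply Rmult_le_pos. }
  intros s h hs.
  apply Rle_trans with (1 := ctl_lipschitz _ _ _ ctl _ _ h
    (ctl_convex _ _ _ ctl a b s ha hb hs) hb).
  apply Rmult_le_compat_r; [apply norm_nonneg |].
  apply Rmult_le_compat_l; [easy |].
  replace (minus (plus b (scal s (minus a b))) b)
    with (scal s (minus a b)) by vec.
  rewrite norm_scal_H, Rabs_pos_eq by lra. nra.
Qed.

Lemma zero_linear : is_linear (fun _ : H => (zero : H)).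
Proof. exact is_linear_zero. Qed.

Lemma increment_le B L D a b :
  controlled B L D -> B a -> B b ->
  norm (minus (F a) (F b)) <= D * norm (minus a b).
Proof.
  intros ctl ha hb.
  apply Rle_trans with (norm (minus (minus (F a) (F b)) zero)).
  { right. f_equal. vec. }
  apply (norm_increment_le a b (fun _ => zero));
    [exact zero_linear | apply ctl |].
  intros s h hs.
  apply Rle_trans with (norm (dF (plus b (scal s (minus a b))) h)).
  { right. f_equal. vec. }
  apply (ctl_bound _ _ _ ctl). now apply (ctl_convex _ _ _ ctl).
Qed.

Lemma lipschitz_op_norm B :
  op_lipschitz_on B dF ->
  exists L, 0 <= L /\ forall a b h, B a -> B b ->
    norm (minus (dF a h) (dF b h)) <= L * norm (minus a b) * norm h.
Proof.
  intros [L [hL lip]]. exists L. split; [easy |]. intros a b h ha hb.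
  apply (le_op_norm (fun h => minus (dF a h) (dF b h))); [| now apply lip].
  intros k x. rewrite !(lin_scal _ (differential_linear _)). vec.
Qed.

Lemma controlled_ball :
  op_locally_lipschitz dF -> (forall h, dF zero h = zero) ->
  forall r, 0 <= r -> exists L, controlled (fun x => norm x <= r) L (L * r).
Proof.
  intros lip d0 r hr.
  destruct (lipschitz_op_norm (fun x => norm x <= r)) as [L [hL BL]].
  { apply lip. now exists r. }
  exists L. split; try easy.
  - now apply Rmult_le_pos.
  - intros a b s ha hb hs.
    replace (plus b (scal s (minus a b)))
      with (plus (scal (1 - s) b) (scal s a)) by vec.
    apply Rle_trans with (1 := norm_plus_le _ _).
    rewrite !norm_scal_H, !Rabs_pos_eq by lra.
    assert ((1 - s) * norm b <= (1 - s) * r) by (apply Rmult_le_compat_l; lra).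
    assert (s * norm a <= s * r) by (apply Rmult_le_compat_l; lra). lra.
  - intros a h ha.
    apply Rle_trans with (norm (minus (dF a h) (dF zero h))).
    { right. f_equal. rewrite d0. vec. }
    assert (z : norm (zero : H) <= r) by (rewrite norm_zero_H; exact hr).
    apply Rle_trans with (1 := BL a zero h ha z).
    apply Rmult_le_compat_r; [apply norm_nonneg |].
    apply Rmult_le_compat_l; [easy |].
    apply Rle_trans with (norm a); [| exact ha]. right. f_equal. vec.
Qed.

Lemma controlled_global :
  globally_lipschitz F -> op_globally_lipschitz dF ->
  exists L D, controlled (fun _ => True) L D.
Proof.
  intros [D [hD lipF]] lip.
  destruct (lipschitz_op_norm _ lip) as [L [hL BL]].
  exists L, D. split; try easy.
  intros a h _.
  (* the differential inherits the Lipschitz constant of the map *)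
  apply (le_of_le_small_multiple _ _ (norm h)). intros e he.
  destruct (proj1 (filterdiff_norm F (dF a) a) (proj1 hF a)) as [lin Df].
  destruct (Df e (proj1 he)) as [d [hd B]].
  assert (ph := norm_nonneg h).
  pose (s := d / 2 / (norm h + 1)).
  assert (hs : 0 < s) by (apply Rdiv_lt_0_compat; lra).
  pose (y := plus a (scal s h)).
  assert (Ey : minus y a = scal s h) by (unfold y; vec).
  specialize (B y).
  assert (lip_y : norm (minus (F y) (F a)) <= D * norm (minus y a))
    by exact (lipF y a I I).
  rewrite Ey, norm_scal_H, Rabs_pos_eq in B, lip_y by lra.
  assert (near : s * norm h < d).
  { apply Rle_lt_trans with (s * (norm h + 1)).
    - apply Rmult_le_compat_l; lra.
    - replace (s * (norm h + 1)) with (d / 2) by (unfold s; field; lra). lra. }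
  specialize (B near). rewrite (lin_scal _ lin) in B.
  assert (tri := norm_le_minus (scal s (dF a h)) (minus (F y) (F a))).
  rewrite (norm_minus_comm (scal s (dF a h))) in tri.
  rewrite norm_scal_H, Rabs_pos_eq in tri by lra.
  apply Rmult_le_reg_l with s; [easy |]. lra.
Qed.

End C1.

(** * The nonlinear flow and its linearisation *)

Section Flow.
Context {H : Hilbert} (A : linear_operator H H) (S : R -> H -> H)
  (hS : is_C0_semigroup S) (hA : opp_is_generator S A)
  (F : H -> H) (dF : H -> H -> H)
  (hF : is_C1 F dF) (hdF : op_locally_lipschitz dF)
  (hF0 : F zero = zero) (hdF0 : forall h, dF zero h = zero)
  (alpha : R) (alpha_pos : 0 < alpha)
  (hii : forall w h, dom A h ->
     inner (plus (A h) (dF w h)) h >= alpha * norm h ^ 2)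
  (T : R -> H -> H)
  (hT : forall w, is_mild_solution S F w (fun t => T t w)).

Implicit Types (v w h k z : H).

Local Notation decay t := (exp (- alpha * t)).

Lemma coercive_dF p : coercive A alpha (dF p).
Proof. split; [now apply (differential_linear F) | apply hii]. Qed.

Lemma decay_sq_le t : 0 <= t -> decay t ^ 2 <= decay t.
Proof.
  intros ht. assert (e := exp_decay_le alpha alpha_pos t ht). simpl. nra.
Qed.

(** Solutions of the equation linearised along a curve [p], up to a decaying
    defect, are close when they start together. *)
Lemma linear_comparison (p : R -> H) g q rho :
  evolves S g q -> q 0 = zero -> 0 <= rho ->
  (forall t, 0 <= t ->
     norm (plus (g t) (dF (p t) (q t))) <= rho * decay t ^ 2) ->
  forall t, 0 <= t -> norm (q t) <= rho / alpha * decay t.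
Proof.
  intros ev q0 hrho B t ht.
  assert (N := energy_estimate S hS A hA alpha alpha_pos g q rho ev hrho).
  rewrite q0 in N.
  assert (z : norm (zero : H) + rho / alpha = rho / alpha)
    by (rewrite norm_zero_H; ring).
  rewrite <- z. apply N; [| easy].
  intros s hs. exists (dF (p s)). split; [apply coercive_dF |].
  apply Rle_trans with (1 := cauchy_schwarz _ _).
  apply Rmult_le_compat_r; [apply norm_nonneg | now apply B].
Qed.

(** Paired with [u - v], the increment of [F] acts as [dF p] for some [p] on the
    segment, so coercivity at [p] controls the difference of the solutions. *)
Lemma solutions_contract (u v : R -> H) :
  evolves S (fun t => opp (F (u t))) u ->
  evolves S (fun t => opp (F (v t))) v ->
  forall t, 0 <= t ->
    norm (minus (u t) (v t)) <= norm (minus (u 0) (v 0)) * decay t.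
Proof.
  intros eu ev t ht.
  assert (N := energy_estimate S hS A hA alpha alpha_pos _ _ 0
    (evolves_minus S hS _ _ _ _ eu ev) (Rle_refl 0)).
  cbv beta in N.
  apply Rle_trans with ((norm (minus (u 0) (v 0)) + 0 / alpha) * decay t).
  2:{ right. field. lra. }
  apply N; [| easy].
  intros s hs.
  destruct (inner_mean_value F dF hF (u s) (v s) (minus (u s) (v s)))
    as [theta [_ E]].
  exists (dF (plus (v s) (scal theta (minus (u s) (v s))))).
  split; [apply coercive_dF |].
  rewrite inner_plus_l, <- E. right. repeat inner_expand. ring.
Qed.

Lemma flow_evolves w : evolves S (fun t => opp (F (T t w))) (fun t => T t w).
Proof.
  apply (mild_evolves S hS F w); [| apply hT].
  intros x. now apply (C1_continuous F dF).
Qed.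

Lemma flow_continuous w : continuous_on (fun t => 0 <= t) (fun t : R => T t w).
Proof. apply flow_evolves. Qed.

Lemma flow_0 w : T 0 w = w.
Proof. exact (mild_initial S hS F w _ (hT w)). Qed.

Lemma flow_contract t v w :
  0 <= t -> norm (minus (T t v) (T t w)) <= norm (minus v w) * decay t.
Proof.
  intros ht.
  rewrite <- (flow_0 v) at 2. rewrite <- (flow_0 w) at 2.
  exact (solutions_contract _ _ (flow_evolves v) (flow_evolves w) t ht).
Qed.

Lemma flow_zero t : 0 <= t -> T t zero = zero.
Proof.
  intros ht. apply eq_of_norm_minus.
  assert (ev : evolves S (fun t => opp (F ((fun _ : R => (zero : H)) t)))
                 (fun _ => zero)).
  { split.
    - intros s hs. apply filterlim_const.
    - intros s hs e he. exists 1. split; [lra |]. intros h hh.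
      rewrite hF0, (lin_zero _ (semigroup_linear S hS h ltac:(lra))).
      apply Rle_trans with (norm (zero : H)).
      + right. f_equal. vec.
      + rewrite norm_zero_H. apply Rmult_le_pos; lra. }
  apply Rle_trans with
    (1 := solutions_contract _ _ (flow_evolves zero) ev t ht).
  cbv beta. rewrite flow_0, norm_minus_diag. lra.
Qed.

Lemma flow_bound t w : 0 <= t -> norm (T t w) <= norm w * decay t.
Proof.
  intros ht. assert (B := flow_contract t w zero ht).
  rewrite flow_zero in B by easy.
  apply Rle_trans with (norm (minus (T t w) zero)).
  { right. f_equal. vec. }
  apply Rle_trans with (1 := B). right. f_equal. f_equal. vec.
Qed.

Lemma flow_bound_ball t w r : 0 <= t -> norm w <= r -> norm (T t w) <= r.
Proof.
  intros ht hw. apply Rle_trans with (1 := flow_bound t w ht).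
  assert (e := exp_decay_le alpha alpha_pos t ht).
  assert (pw := norm_nonneg w). nra.
Qed.

Lemma flow_semigroup s t w : 0 <= s -> 0 <= t -> T (t + s) w = T t (T s w).
Proof.
  intros hs ht. apply eq_of_norm_minus.
  apply Rle_trans with (1 := solutions_contract (fun t => T (t + s) w)
    (fun t => T t (T s w)) (evolves_shift S _ _ s hs (flow_evolves w))
    (flow_evolves (T s w)) t ht).
  cbv beta. rewrite flow_0, Rplus_0_l, norm_minus_diag. lra.
Qed.

Lemma flow_right_derivative w :
  dom A w ->
  little_o (fun h : R => minus (minus (T h w) w)
                       (scal h (opp (plus (A w) (F w))))).
Proof.
  intros hw. assert (o1 := proj2 (flow_evolves w) 0 (Rle_refl 0)).
  cbv beta in o1. rewrite flow_0 in o1.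
  eapply little_o_ext;
    [| exact (little_o_plus _ _ o1 (generator_little_o S A hA w hw))].
  intros h hh. cbv beta. rewrite Rplus_0_l. vec.
Qed.

(** * Difference quotients of the flow *)

Definition quotient w h (e : R) t : H :=
  scal (/ e) (minus (T t (plus w (scal e h))) (T t w)).

Definition quotient_rate w h (e : R) t : H :=
  scal (/ e) (minus (opp (F (T t (plus w (scal e h))))) (opp (F (T t w)))).

Lemma quotient_evolves w h e :
  evolves S (quotient_rate w h e) (quotient w h e).
Proof.
  exact (evolves_scal S hS _ _ (/ e) (evolves_minus S hS _ _ _ _
    (flow_evolves (plus w (scal e h))) (flow_evolves w))).
Qed.

Lemma quotient_0 w h e : 0 < e -> quotient w h e 0 = h.
Proof.
  intros he. unfold quotient. rewrite !flow_0. vec. field. lra.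
Qed.

Lemma quotient_bound w h e t :
  0 < e -> 0 <= t -> norm (quotient w h e t) <= norm h * decay t.
Proof.
  intros he ht. unfold quotient.
  assert (pe : 0 < / e) by now apply Rinv_0_lt_compat.
  rewrite norm_scal_H, (Rabs_pos_eq (/ e)) by lra.
  apply Rle_trans with (/ e * (norm (scal e h) * decay t)).
  - apply Rmult_le_compat_l; [lra |].
    apply Rle_trans with (1 := flow_contract t _ _ ht).
    right. f_equal. f_equal. vec.
  - right. rewrite norm_scal_H, Rabs_pos_eq; [field |]; lra.
Qed.

(** Taylor's formula for [F] gives a defect of second order in the increment,
    hence of first order in [e] after division. *)
Lemma quotient_defect r L D w h e t :
  controlled dF (fun x => norm x <= r) L D -> norm w + norm h <= r ->
  0 < e <= 1 -> 0 <= t ->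
  norm (plus (quotient_rate w h e t) (dF (T t w) (quotient w h e t)))
    <= L * norm h * norm h * e * decay t ^ 2.
Proof.
  intros ctl hr he ht.
  assert (pw := norm_nonneg w). assert (ph := norm_nonneg h).
  assert (hL := ctl_L _ _ _ _ ctl).
  pose (v := plus w (scal e h) : H).
  assert (hv : norm v <= r).
  { apply Rle_trans with (norm w + norm (scal e h)); [apply norm_plus_le |].
    expand_norm_scal. rewrite Rabs_pos_eq by lra. nra. }
  assert (B := taylor F dF hF _ L D (T t v) (T t w) ctl
    (flow_bound_ball t v r ht hv) (flow_bound_ball t w r ht ltac:(lra))).
  assert (C : norm (minus (T t v) (T t w)) <= norm (minus v w) * decay t)
    by exact (flow_contract t v w ht).
  assert (lin := differential_linear F dF hF (T t w)).
  assert (E : plus (quotient_rate w h e t) (dF (T t w) (quotient w h e t))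
    = scal (/ e) (opp (minus (minus (F (T t v)) (F (T t w)))
                        (dF (T t w) (minus (T t v) (T t w)))))).
  { change (quotient_rate w h e t)
      with (scal (/ e) (minus (opp (F (T t v))) (opp (F (T t w))))).
    change (quotient w h e t) with (scal (/ e) (minus (T t v) (T t w))).
    rewrite (lin_scal _ lin). vec. }
  rewrite E.
  assert (pe : 0 < / e) by (apply Rinv_0_lt_compat; lra).
  rewrite norm_scal_H, norm_opp_H, Rabs_pos_eq by lra.
  assert (Evw : norm (minus v w) = e * norm h).
  { transitivity (norm (scal e h)).
    - f_equal. unfold v. vec.
    - expand_norm_scal. rewrite Rabs_pos_eq; lra. }
  rewrite Evw in C.
  assert (pd := norm_nonneg (minus (T t v) (T t w))).
  apply Rle_trans with
    (/ e * (L * (e * norm h * decay t) * (e * norm h * decay t))).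
  - apply Rmult_le_compat_l; [lra |]. apply Rle_trans with (1 := B).
    apply Rmult_le_compat; try easy.
    + now apply Rmult_le_pos.
    + now apply Rmult_le_compat_l.
  - right. field. lra.
Qed.

Lemma quotient_cauchy r L D w h e1 e2 t :
  controlled dF (fun x => norm x <= r) L D -> norm w + norm h <= r ->
  0 < e1 <= 1 -> 0 < e2 <= 1 -> 0 <= t ->
  norm (minus (quotient w h e1 t) (quotient w h e2 t))
    <= L * norm h * norm h / alpha * (e1 + e2) * decay t.
Proof.
  intros ctl hr he1 he2 ht.
  assert (ph := norm_nonneg h). assert (hL := ctl_L _ _ _ _ ctl).
  assert (hLh : 0 <= L * norm h * norm h)
    by (repeat apply Rmult_le_pos; easy).
  replace (L * norm h * norm h / alpha * (e1 + e2))
    with (L * norm h * norm h * (e1 + e2) / alpha) by (field; lra).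
  apply (linear_comparison (fun t => T t w)
    (fun t => minus (quotient_rate w h e1 t) (quotient_rate w h e2 t))
    (fun t => minus (quotient w h e1 t) (quotient w h e2 t))); [| | | | easy].
  - exact (evolves_minus S hS _ _ _ _ (quotient_evolves w h e1)
      (quotient_evolves w h e2)).
  - rewrite !quotient_0 by easy. vec.
  - apply Rmult_le_pos; lra.
  - intros s hs. assert (lin := differential_linear F dF hF (T s w)).
    rewrite (lin_minus _ lin).
    assert (B1 := quotient_defect r L D w h e1 s ctl hr he1 hs).
    assert (B2 := quotient_defect r L D w h e2 s ctl hr he2 hs).
    apply Rle_trans with (norm (minus
      (plus (quotient_rate w h e1 s) (dF (T s w) (quotient w h e1 s)))
      (plus (quotient_rate w h e2 s) (dF (T s w) (quotient w h e2 s))))).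
    { right. f_equal. vec. }
    apply Rle_trans with (1 := norm_minus_le _ _). lra.
Qed.

(** The rate of convergence is part of the definition, for every control on a
    ball that contains [w] and [w + h]: it is the estimate from which all
    properties of the differential are derived. *)
Definition is_variation t w h z : Prop :=
  forall r L D, controlled dF (fun x => norm x <= r) L D ->
    norm w + norm h <= r -> forall e, 0 < e <= 1 ->
    norm (minus (quotient w h e t) z)
      <= L * norm h * norm h / alpha * e * decay t.

(** The difference quotients form a Cauchy family as [e] decreases to [0]. *)
Lemma variation_exists t w h : 0 <= t -> exists z, is_variation t w h z.
Proof.
  intros ht. pose (x := fun n : nat => quotient w h (/ (INR n + 1)) t).
  assert (pw := norm_nonneg w). assert (ph := norm_nonneg h).
  assert (he : forall n, 0 < / (INR n + 1) <= 1).
  { intros n. assert (hn := pos_INR n). split.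
    - apply Rinv_0_lt_compat. lra.
    - rewrite <- Rinv_1. apply Rinv_le_contravar; lra. }
  assert (small : forall c e, 0 <= c -> 0 < e -> exists N, forall n,
    (N <= n)%nat -> c * / (INR n + 1) <= e).
  { intros c e hc pe. destruct (INR_archimed e c pe) as [N hN]. exists N.
    intros n hn. apply le_INR in hn. assert (p := pos_INR N).
    apply Rmult_le_reg_r with (INR n + 1); [lra |].
    rewrite Rmult_assoc, Rinv_l by lra. nra. }
  assert (pd := exp_decay_le alpha alpha_pos t ht).
  destruct (cauchy_sequence_converges x) as [z hz].
  { intros e pe.
    destruct (controlled_ball F dF hF hdF hdF0 (norm w + norm h)) as [L ctl];
      [lra |].
    assert (hL := ctl_L _ _ _ _ ctl).
    pose (c := L * norm h * norm h / alpha).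
    assert (hc : 0 <= c).
    { apply Rle_mult_inv_pos; [repeat apply Rmult_le_pos |]; easy. }
    destruct (small c (e / 2) hc) as [N hN]; [lra |].
    exists N. intros n m hn hm.
    apply Rle_trans with (1 := quotient_cauchy _ L _ w h _ _ t ctl
      (Rle_refl _) (he n) (he m) ht). fold c.
    assert (a := hN n hn). assert (b := hN m hm).
    assert (pn := he n). assert (qm := he m).
    assert (0 <= c * (/ (INR n + 1) + / (INR m + 1)))
      by (apply Rmult_le_pos; lra).
    nra. }
  exists z. intros r L D ctl hr e pe.
  assert (hL := ctl_L _ _ _ _ ctl).
  pose (c := L * norm h * norm h / alpha). fold c.
  assert (hc : 0 <= c).
  { apply Rle_mult_inv_pos; [repeat apply Rmult_le_pos |]; easy. }
  apply le_epsilon. intros e' pe'.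
  destruct (hz (e' / 2)) as [N1 h1]; [lra |].
  destruct (small c (e' / 2) hc) as [N2 h2]; [lra |].
  pose (n := Nat.max N1 N2).
  specialize (h1 n ltac:(lia)). specialize (h2 n ltac:(lia)).
  assert (q := quotient_cauchy r L D w h e (/ (INR n + 1)) t ctl hr pe (he n)
    ht).
  fold c in q. assert (tri := norm_minus_triangle (quotient w h e t) (x n) z).
  assert (pn := he n).
  assert (0 <= c * / (INR n + 1)) by (apply Rmult_le_pos; lra).
  assert (c * / (INR n + 1) * decay t <= c * / (INR n + 1) * 1)
    by (apply Rmult_le_compat_l; lra).
  change (quotient w h (/ (INR n + 1)) t) with (x n) in q. lra.
Qed.

Lemma variation_family :
  exists dT : R -> H -> H -> H,
    forall t w h, 0 <= t -> is_variation t w h (dT t w h).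
Proof.
  destruct (functional_choice (fun (p : R * (H * H)) z =>
    0 <= fst p -> is_variation (fst p) (fst (snd p)) (snd (snd p)) z))
    as [f hf].
  - intros [t [w h]]. simpl. destruct (Rle_or_lt 0 t) as [ht | ht].
    + destruct (variation_exists t w h ht) as [z hz]. now exists z.
    + exists zero. intros ht'. lra.
  - exists (fun t w h => f (t, (w, h))). intros t w h.
    exact (hf (t, (w, h))).
Qed.

(** * The differential of the flow *)

Section Variation.
Context (dT : R -> H -> H -> H)
  (hdT : forall t w h, 0 <= t -> is_variation t w h (dT t w h)).

Lemma variation_approx w h :
  exists c, 0 <= c /\ forall e t, 0 < e <= 1 -> 0 <= t ->
    norm (plus (quotient_rate w h e t) (dF (T t w) (quotient w h e t)))
      <= c * e * decay t ^ 2 /\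
    norm (minus (quotient w h e t) (dT t w h)) <= c * e * decay t.
Proof.
  assert (pw := norm_nonneg w). assert (ph := norm_nonneg h).
  destruct (controlled_ball F dF hF hdF hdF0 (norm w + norm h)) as [L ctl];
    [lra |].
  assert (hL := ctl_L _ _ _ _ ctl).
  assert (hLh : 0 <= L * norm h * norm h)
    by (repeat apply Rmult_le_pos; easy).
  assert (hLa : 0 <= L * norm h * norm h / alpha)
    by (apply Rle_mult_inv_pos; easy).
  exists (L * norm h * norm h + L * norm h * norm h / alpha).
  split; [lra |]. intros e t he ht.
  assert (pd := exp_pos (- alpha * t)).
  assert (pd2 : 0 < decay t ^ 2) by now apply pow_lt.
  assert (0 <= L * norm h * norm h * e * decay t)
    by (apply Rmult_le_pos; [apply Rmult_le_pos |]; lra).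
  assert (0 <= L * norm h * norm h / alpha * e * decay t ^ 2)
    by (apply Rmult_le_pos; [apply Rmult_le_pos |]; lra).
  split.
  - apply Rle_trans with
      (1 := quotient_defect _ L _ w h e t ctl (Rle_refl _) he ht). lra.
  - apply Rle_trans with (1 := hdT t w h ht _ L _ ctl (Rle_refl _) e he). lra.
Qed.

Lemma variation_bound t w h :
  0 <= t -> norm (dT t w h) <= norm h * decay t.
Proof.
  intros ht. destruct (variation_approx w h) as [c [hc B]].
  apply (le_of_le_small_multiple _ _ (c * decay t)). intros e he.
  destruct (B e t he ht) as [_ B2].
  assert (q := quotient_bound w h e t (proj1 he) ht).
  assert (tri := norm_le_minus (dT t w h) (quotient w h e t)).
  rewrite norm_minus_comm in tri. lra.
Qed.

(** The corresponding combination of difference quotients starts at [0] and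
    solves the linearised equation up to a defect of order [e]. *)
Lemma variation_combination t w (a b : R) h k :
  0 <= t ->
  dT t w (plus (scal a h) (scal b k))
  = plus (scal a (dT t w h)) (scal b (dT t w k)).
Proof.
  intros ht. set (l := plus (scal a h) (scal b k)).
  destruct (variation_approx w l) as [c [hc B]].
  destruct (variation_approx w h) as [c1 [hc1 B1]].
  destruct (variation_approx w k) as [c2 [hc2 B2]].
  assert (pa := Rabs_pos a). assert (pb := Rabs_pos b).
  pose (m := c + Rabs a * c1 + Rabs b * c2).
  assert (0 <= Rabs a * c1) by (apply Rmult_le_pos; lra).
  assert (0 <= Rabs b * c2) by (apply Rmult_le_pos; lra).
  assert (hm : 0 <= m) by (unfold m; lra).
  assert (split3 : forall x y z : H,
    norm (minus (minus x (scal a y)) (scal b z))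
      <= norm x + Rabs a * norm y + Rabs b * norm z).
  { intros x y z. apply Rle_trans with (1 := norm_minus_le _ _).
    rewrite norm_scal_H.
    assert (n := norm_minus_le x (scal a y)). rewrite norm_scal_H in n. lra. }
  apply eq_of_norm_minus.
  apply (le_of_le_small_multiple _ 0 ((m / alpha + m) * decay t)).
  intros e he.
  assert (lin : forall s, is_linear (dF (T s w)))
    by (intros s; now apply (differential_linear F)).
  pose (Q := fun s => minus (minus (quotient w l e s)
    (scal a (quotient w h e s))) (scal b (quotient w k e s))).
  assert (N : norm (Q t) <= m * e / alpha * decay t).
  { apply (linear_comparison (fun t => T t w)
      (fun s => minus (minus (quotient_rate w l e s)
        (scal a (quotient_rate w h e s))) (scal b (quotient_rate w k e s))) Q);
      [| | | | easy].
    - exact (evolves_minus S hS _ _ _ _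
        (evolves_minus S hS _ _ _ _ (quotient_evolves w l e)
          (evolves_scal S hS _ _ a (quotient_evolves w h e)))
        (evolves_scal S hS _ _ b (quotient_evolves w k e))).
    - unfold Q. rewrite !quotient_0 by easy. unfold l. vec.
    - apply Rmult_le_pos; lra.
    - intros s hs. unfold Q.
      rewrite !(lin_minus _ (lin s)), !(lin_scal _ (lin s)).
      destruct (B e s he hs) as [D0 _]. destruct (B1 e s he hs) as [D1 _].
      destruct (B2 e s he hs) as [D2 _].
      apply Rle_trans with (norm (minus (minus
        (plus (quotient_rate w l e s) (dF (T s w) (quotient w l e s)))
        (scal a (plus (quotient_rate w h e s) (dF (T s w) (quotient w h e s)))))
        (scal b (plus (quotient_rate w k e s)
                   (dF (T s w) (quotient w k e s)))))).
      { right. f_equal. vec. }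
      apply Rle_trans with (1 := split3 _ _ _). unfold m.
      apply (Rmult_le_compat_l _ _ _ pa) in D1.
      apply (Rmult_le_compat_l _ _ _ pb) in D2. lra. }
  destruct (B e t he ht) as [_ D0]. destruct (B1 e t he ht) as [_ D1].
  destruct (B2 e t he ht) as [_ D2].
  apply Rle_trans with (norm (minus (Q t)
    (minus (minus (minus (quotient w l e t) (dT t w l))
      (scal a (minus (quotient w h e t) (dT t w h))))
      (scal b (minus (quotient w k e t) (dT t w k)))))).
  { right. f_equal. unfold Q. vec. }
  apply Rle_trans with (1 := norm_minus_le _ _).
  assert (D := split3 (minus (quotient w l e t) (dT t w l))
    (minus (quotient w h e t) (dT t w h))
    (minus (quotient w k e t) (dT t w k))).
  apply (Rmult_le_compat_l _ _ _ pa) in D1.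
  apply (Rmult_le_compat_l _ _ _ pb) in D2.
  replace (m * e / alpha * decay t) with (m / alpha * decay t * e) in N
    by (field; lra).
  unfold m in *. lra.
Qed.

Lemma variation_linear t w : 0 <= t -> is_linear (dT t w).
Proof.
  intros ht. split.
  - intros x y. assert (E := variation_combination t w 1 1 x y ht).
    etransitivity; [apply f_equal | etransitivity; [exact E |]]; vec.
  - intros k x. assert (E := variation_combination t w k 0 x x ht).
    etransitivity; [apply f_equal | etransitivity; [exact E |]]; vec.
  - exists 1. split; [lra |]. intros x.
    apply Rle_trans with (1 := variation_bound t w x ht).
    assert (e := exp_decay_le alpha alpha_pos t ht).
    assert (px := norm_nonneg x). rewrite Rmult_1_l.
    rewrite <- (Rmult_1_r (norm x)) at 2. apply Rmult_le_compat_l; lra.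
Qed.

(** The estimate of [is_variation] at [e = 1]. *)
Lemma flow_taylor r L D t v w :
  controlled dF (fun x => norm x <= r) L D ->
  norm w + norm (minus v w) <= r -> 0 <= t ->
  norm (minus (minus (T t v) (T t w)) (dT t w (minus v w)))
    <= L * norm (minus v w) * norm (minus v w) / alpha * decay t.
Proof.
  intros ctl hr ht.
  assert (B := hdT t w (minus v w) ht r L D ctl hr 1 ltac:(lra)).
  rewrite Rmult_1_r in B. apply Rle_trans with (2 := B).
  right. f_equal. apply (f_equal (fun z => minus z (dT t w (minus v w)))).
  transitivity (scal (/ 1) (minus (T t v) (T t w))); [vec; field |].
  apply (f_equal (fun z => scal (/ 1) (minus (T t z) (T t w)))). vec.
Qed.

Lemma flow_differentiable t w : 0 <= t -> filterdiff (T t) (locally w) (dT t w).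
Proof.
  intros ht. apply filterdiff_norm. split; [now apply variation_linear |].
  assert (pw := norm_nonneg w).
  destruct (controlled_ball F dF hF hdF hdF0 (norm w + 1)) as [L ctl]; [lra |].
  assert (hL := ctl_L _ _ _ _ ctl).
  assert (hLa : 0 <= L / alpha) by (apply Rle_mult_inv_pos; easy).
  intros e he.
  assert (pe : 0 < e / (L / alpha + 1)) by (apply Rdiv_lt_0_compat; lra).
  exists (Rmin 1 (e / (L / alpha + 1))). split; [apply Rmin_glb_lt; lra |].
  intros v hv.
  assert (l1 := Rmin_l 1 (e / (L / alpha + 1))).
  assert (l2 := Rmin_r 1 (e / (L / alpha + 1))).
  assert (pn := norm_nonneg (minus v w)).
  assert (vw1 : norm (minus v w) <= 1)
    by exact (Rlt_le _ _ (Rlt_le_trans _ _ _ hv l1)).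
  assert (vw2 : norm (minus v w) <= e / (L / alpha + 1))
    by exact (Rlt_le _ _ (Rlt_le_trans _ _ _ hv l2)).
  assert (hr : norm w + norm (minus v w) <= norm w + 1) by lra.
  apply Rle_trans with (1 := flow_taylor _ L _ t v w ctl hr ht).
  assert (pd := exp_decay_le alpha alpha_pos t ht).
  replace (L * norm (minus v w) * norm (minus v w) / alpha)
    with (L / alpha * norm (minus v w) * norm (minus v w)) by (field; lra).
  assert (a : L / alpha * norm (minus v w) <= e).
  { apply Rle_trans with ((L / alpha + 1) * (e / (L / alpha + 1))).
    - apply Rmult_le_compat; lra.
    - right. unfold Rdiv at 2. rewrite (Rmult_comm e), <- Rmult_assoc.
      rewrite Rinv_r; lra. }
  apply Rle_trans with (L / alpha * norm (minus v w) * norm (minus v w) * 1).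
  - apply Rmult_le_compat_l; [| lra].
    apply Rmult_le_pos; [apply Rmult_le_pos |]; easy.
  - rewrite Rmult_1_r. now apply Rmult_le_compat_r.
Qed.

(** The defects of the two quotients are of order [e]; linearising both along
    the orbit of [w] adds the defect [(dF (T t v) - dF (T t w)) q], which does
    not vanish with [e] and gives the bound. *)
Lemma variation_lipschitz (B : H -> Prop) L D t v w h :
  controlled dF B L D -> (forall s x, 0 <= s -> B x -> B (T s x)) ->
  B v -> B w -> 0 <= t ->
  norm (minus (dT t v h) (dT t w h))
    <= L * norm (minus v w) * norm h / alpha * decay t.
Proof.
  intros ctl inv hv hw ht.
  assert (hL := ctl_L _ _ _ _ ctl).
  assert (pn := norm_nonneg (minus v w)). assert (ph := norm_nonneg h).
  destruct (variation_approx v h) as [c1 [hc1 B1]].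
  destruct (variation_approx w h) as [c2 [hc2 B2]].
  pose (m := L * norm (minus v w) * norm h).
  assert (hm : 0 <= m) by (unfold m; repeat apply Rmult_le_pos; easy).
  apply (le_of_le_small_multiple _ _
    (((c1 + c2) / alpha + (c1 + c2)) * decay t)).
  intros e he. fold m.
  assert (N : norm (minus (quotient v h e t) (quotient w h e t))
              <= (m + (c1 + c2) * e) / alpha * decay t).
  { apply (linear_comparison (fun s => T s w)
      (fun s => minus (quotient_rate v h e s) (quotient_rate w h e s))
      (fun s => minus (quotient v h e s) (quotient w h e s))); [| | | | easy].
    - apply (evolves_minus S hS); apply quotient_evolves.
    - rewrite !quotient_0 by easy. vec.
    - assert (0 <= (c1 + c2) * e) by (apply Rmult_le_pos; lra). lra.
    - intros s hs.
      destruct (B1 e s he hs) as [D1 _]. destruct (B2 e s he hs) as [D2 _].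
      rewrite (lin_minus _ (differential_linear F dF hF (T s w))).
      assert (D3 : norm (minus (dF (T s v) (quotient v h e s))
                          (dF (T s w) (quotient v h e s)))
                   <= m * decay s ^ 2).
      { apply Rle_trans with (1 := ctl_lipschitz _ _ _ _ ctl (T s v) (T s w)
          (quotient v h e s) (inv s v hs hv) (inv s w hs hw)).
        replace (m * decay s ^ 2) with
          (L * (norm (minus v w) * decay s) * (norm h * decay s))
          by (unfold m; ring).
        apply Rmult_le_compat.
        - apply Rmult_le_pos; [easy | apply norm_nonneg].
        - apply norm_nonneg.
        - apply Rmult_le_compat_l; [easy | now apply flow_contract].
        - now apply quotient_bound. }
      apply Rle_trans with (norm (minus (minus
        (plus (quotient_rate v h e s) (dF (T s v) (quotient v h e s)))
        (plus (quotient_rate w h e s) (dF (T s w) (quotient w h e s))))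
        (minus (dF (T s v) (quotient v h e s))
               (dF (T s w) (quotient v h e s))))).
      { right. f_equal. vec. }
      apply Rle_trans with (1 := norm_minus_le _ _).
      assert (n := norm_minus_le
        (plus (quotient_rate v h e s) (dF (T s v) (quotient v h e s)))
        (plus (quotient_rate w h e s) (dF (T s w) (quotient w h e s)))).
      lra. }
  destruct (B1 e t he ht) as [_ D1]. destruct (B2 e t he ht) as [_ D2].
  apply Rle_trans with (norm (minus
    (minus (quotient v h e t) (quotient w h e t))
    (minus (minus (quotient v h e t) (dT t v h))
           (minus (quotient w h e t) (dT t w h))))).
  { right. f_equal. vec. }
  apply Rle_trans with (1 := norm_minus_le _ _).
  assert (n := norm_minus_le (minus (quotient v h e t) (dT t v h))
                 (minus (quotient w h e t) (dT t w h))).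
  replace ((m + (c1 + c2) * e) / alpha * decay t)
    with (m / alpha * decay t + (c1 + c2) / alpha * decay t * e) in N
    by (field; lra).
  lra.
Qed.

(** A uniform limit of difference quotients. *)
Lemma variation_continuous w h :
  continuous_on (fun t => 0 <= t) (fun t : R => dT t w h).
Proof.
  apply continuous_on_half_line. intros t ht e he.
  destruct (variation_approx w h) as [c [hc B]].
  pose (k := Rmin 1 (e / 3 / (c + 1))).
  assert (hk : 0 < k).
  { apply Rmin_glb_lt; [lra |]. apply Rdiv_lt_0_compat; lra. }
  assert (k1 : k <= 1) by apply Rmin_l.
  assert (kc : c * k <= e / 3).
  { apply Rle_trans with ((c + 1) * (e / 3 / (c + 1))).
    - apply Rmult_le_compat; try lra. apply Rmin_r.
    - right. field. lra. }
  assert (near : forall s, 0 <= s ->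
    norm (minus (quotient w h k s) (dT s w h)) <= e / 3).
  { intros s hs. destruct (B k s ltac:(lra) hs) as [_ D].
    assert (pd := exp_decay_le alpha alpha_pos s hs).
    apply Rle_trans with (1 := D).
    apply Rle_trans with (c * k * 1); [| lra].
    apply Rmult_le_compat_l; [apply Rmult_le_pos |]; lra. }
  destruct (proj1 (continuous_on_half_line _)
    (proj1 (quotient_evolves w h k)) t ht (e / 3)) as [d [hd Bd]]; [lra |].
  exists d. split; [easy |]. intros s hs st.
  specialize (Bd s hs st).
  assert (n1 := near s hs). assert (n2 := near t ht).
  rewrite norm_minus_comm in n1.
  assert (t1 := norm_minus_triangle (dT s w h) (quotient w h k s) (dT t w h)).
  assert (t2 := norm_minus_triangle (quotient w h k s) (quotient w h k t)
                  (dT t w h)).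
  lra.
Qed.

Section Observation.
Context {Z : Hilbert}
  (C : linear_operator H Z) (hCA : forall w, dom A w -> dom C w)
  (hi : exists a b : R, 0 < a /\ 0 < b /\
     forall w, dom A w -> norm (C w) <= a * norm (A w) + b * norm w)
  (Ainv : H -> H) (hAinv : is_bounded_inverse A Ainv).

Local Notation K y := (C (Ainv y)).

(** * Integrals along the flow *)

Lemma flow_le_norm t w : 0 <= t -> norm (T t w) <= norm w.
Proof. intros ht. now apply flow_bound_ball. Qed.

Lemma F_flow_continuous w :
  continuous_on (fun t => 0 <= t) (fun t : R => F (T t w)).
Proof.
  apply continuous_on_comp; [| apply flow_continuous].
  intros x. now apply (C1_continuous F dF).
Qed.

Lemma F_flow_bound w :
  exists c, 0 <= c /\ forall t, 0 <= t -> norm (F (T t w)) <= c * decay t.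
Proof.
  assert (pw := norm_nonneg w).
  destruct (controlled_ball F dF hF hdF hdF0 (norm w) pw) as [L ctl].
  assert (hD := ctl_D _ _ _ _ ctl). set (D := L * norm w) in *.
  exists (D * norm w). split; [now apply Rmult_le_pos |].
  intros t ht.
  assert (z : norm (zero : H) <= norm w) by (rewrite norm_zero_H; exact pw).
  apply Rle_trans with (norm (minus (F (T t w)) (F zero))).
  { right. f_equal. rewrite hF0. vec. }
  apply Rle_trans with (1 := increment_le F dF hF _ _ _ _ _ ctl
    (flow_le_norm t w ht) z).
  rewrite Rmult_assoc. apply Rmult_le_compat_l; [easy |].
  apply Rle_trans with (norm (T t w)); [| now apply flow_bound].
  right. f_equal. vec.
Qed.

Lemma F_flow_integral :
  exists J : H -> H, forall w, is_integral_0_infty (fun t => F (T t w)) (J w).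
Proof.
  apply (functional_choice (fun w l =>
    is_integral_0_infty (fun t => F (T t w)) l)).
  intros w.
  destruct (F_flow_bound w) as [c [_ B]].
  exact (ex_integral_0_infty alpha alpha_pos _ c (F_flow_continuous w) B).
Qed.

Lemma dF_flow_bound (B : H -> Prop) L D t w h :
  controlled dF B L D -> (forall s x, 0 <= s -> B x -> B (T s x)) ->
  0 <= t -> B w ->
  norm (dF (T t w) (dT t w h)) <= D * norm h * decay t.
Proof.
  intros ctl inv ht hw.
  apply Rle_trans with (1 := ctl_bound _ _ _ _ ctl _ _ (inv t w ht hw)).
  rewrite Rmult_assoc.
  apply Rmult_le_compat_l;
    [apply (ctl_D _ _ _ _ ctl) | now apply variation_bound].
Qed.

Lemma dF_flow_continuous w h :
  continuous_on (fun t => 0 <= t) (fun t : R => dF (T t w) (dT t w h)).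
Proof.
  assert (pw := norm_nonneg w). assert (ph := norm_nonneg h).
  destruct (controlled_ball F dF hF hdF hdF0 (norm w) pw) as [L ctl].
  assert (hL := ctl_L _ _ _ _ ctl). assert (hD := ctl_D _ _ _ _ ctl).
  set (D := L * norm w) in *.
  apply continuous_on_half_line. intros t ht e he.
  assert (hLh : 0 <= L * norm h) by now apply Rmult_le_pos.
  destruct (proj1 (continuous_on_half_line _) (flow_continuous w) t ht
    (e / 2 / (L * norm h + 1))) as [d1 [hd1 B1]];
    [apply Rdiv_lt_0_compat; lra |].
  destruct (proj1 (continuous_on_half_line _)
    (variation_continuous w h) t ht (e / 2 / (D + 1))) as [d2 [hd2 B2]];
    [apply Rdiv_lt_0_compat; lra |].
  exists (Rmin d1 d2). split; [now apply Rmin_glb_lt |].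
  intros s hs st.
  assert (l1 := Rmin_l d1 d2). assert (l2 := Rmin_r d1 d2).
  specialize (B1 s hs ltac:(lra)). specialize (B2 s hs ltac:(lra)).
  assert (C1 := ctl_lipschitz _ _ _ _ ctl (T s w) (T t w) (dT s w h)
    (flow_le_norm s w hs) (flow_le_norm t w ht)).
  assert (C2 := ctl_bound _ _ _ _ ctl (T t w) (minus (dT s w h) (dT t w h))
    (flow_le_norm t w ht)).
  rewrite (lin_minus _ (differential_linear F dF hF (T t w))) in C2.
  apply Rle_trans with (1 := norm_minus_triangle _ (dF (T t w) (dT s w h)) _).
  assert (vb : norm (dT s w h) <= norm h).
  { apply Rle_trans with (1 := variation_bound s w h hs).
    assert (p := exp_decay_le alpha alpha_pos s hs).
    rewrite <- (Rmult_1_r (norm h)) at 2. apply Rmult_le_compat_l; lra. }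
  assert (D1 : L * norm (minus (T s w) (T t w)) * norm (dT s w h) <= e / 2).
  { apply Rle_trans with
      (L * (e / 2 / (L * norm h + 1)) * norm h).
    - apply Rmult_le_compat.
      + apply Rmult_le_pos; [easy | apply norm_nonneg].
      + apply norm_nonneg.
      + apply Rmult_le_compat_l; [easy | exact B1].
      + exact vb.
    - apply Rle_trans with (e / 2 / (L * norm h + 1) * (L * norm h + 1)).
      + replace (L * (e / 2 / (L * norm h + 1)) * norm h)
          with (e / 2 / (L * norm h + 1) * (L * norm h)) by ring.
        apply Rmult_le_compat_l; [left; apply Rdiv_lt_0_compat |]; lra.
      + right. field. lra. }
  assert (D2 : D * norm (minus (dT s w h) (dT t w h)) <= e / 2).
  { apply Rle_trans with ((D + 1) * (e / 2 / (D + 1))).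
    - apply Rmult_le_compat; [easy | apply norm_nonneg | lra | exact B2].
    - right. field. lra. }
  replace e with (e / 2 + e / 2) by field.
  apply Rplus_le_compat; [exact (Rle_trans _ _ _ C1 D1)
                         | exact (Rle_trans _ _ _ C2 D2)].
Qed.

Lemma dF_flow_integral :
  exists N : H -> H -> H, forall w h,
    is_integral_0_infty (fun t => dF (T t w) (dT t w h)) (N w h).
Proof.
  destruct (functional_choice (fun (p : H * H) l =>
    is_integral_0_infty (fun t => dF (T t (fst p)) (dT t (fst p) (snd p))) l))
    as [f hf].
  - intros [w h]. cbn [fst snd].
    assert (pw := norm_nonneg w).
    destruct (controlled_ball F dF hF hdF hdF0 (norm w) pw) as [L ctl].
    apply (ex_integral_0_infty alpha alpha_pos _ (L * norm w * norm h)
      (dF_flow_continuous w h)).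
    intros t ht. apply (dF_flow_bound _ L (L * norm w) t w h ctl); try easy.
    intros s x hs hx. now apply flow_bound_ball.
  - exists (fun w h => f (w, h)). intros w h. exact (hf (w, h)).
Qed.

(** * The orbit integral *)

(** Both sides have the right derivative [T b w]: applying [Ainv] makes the
    orbit differentiable, since it maps into the domain and commutes with the
    semigroup. *)
Lemma integral_flow w b :
  0 <= b ->
  RInt (fun t => T t w) 0 b
  = Ainv (minus (minus w (T b w)) (RInt (fun t => F (T t w)) 0 b)).
Proof.
  intros hb.
  assert (lin := proj1 hAinv).
  assert (X : forall u : R -> H, continuous_on (fun t => 0 <= t) u ->
    forall a c, 0 <= a <= c -> ex_RInt u a c)
    by (intros u cu a c hac; now apply ex_RInt_half_line).
  pose (P := fun b => RInt (fun t => T t w) 0 b).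
  pose (Q := fun b => RInt (fun t => F (T t w)) 0 b).
  pose (u := fun b => minus (P b) (Ainv (minus (minus w (T b w)) (Q b)))).
  assert (cP : continuous_on (fun t => 0 <= t) P).
  { apply (continuous_on_RInt _ (norm w)); [apply flow_continuous |].
    intros t ht. now apply flow_le_norm. }
  assert (cQ : continuous_on (fun t => 0 <= t) Q).
  { destruct (F_flow_bound w) as [c [hc B]].
    apply (continuous_on_RInt _ c); [apply F_flow_continuous |].
    intros t ht. apply Rle_trans with (1 := B t ht).
    assert (p := exp_decay_le alpha alpha_pos t ht). nra. }
  assert (cu : continuous_on (fun t => 0 <= t) u).
  { apply continuous_on_minus; [exact cP |].
    apply (continuous_on_comp Ainv); [now apply lin_continuous |].
    apply continuous_on_minus; [| exact cQ].
    apply continuous_on_minus; [| apply flow_continuous].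
    intros t ht. apply filterlim_const. }
  assert (oI : forall (f : R -> H) t, continuous_on (fun t => 0 <= t) f ->
    0 <= t ->
    little_o (fun h : R => minus (minus (RInt f 0 (t + h)) (RInt f 0 t))
                             (scal h (f t)))).
  { intros f t cf ht.
    eapply little_o_ext;
      [| apply (little_o_RInt f t (fun h : R => RInt f t (t + h)))];
      [| easy | easy |].
    - intros h h0. cbv beta.
      rewrite <- (RInt_Chasles f 0 t (t + h)); [vec | apply X | apply X];
        easy || lra.
    - intros h h0. apply RInt_correct. apply X; [easy | lra]. }
  assert (du : forall t, 0 <= t ->
    little_o (fun h : R => minus (u (t + h)) (u t))).
  { intros t ht.
    assert (o1 := oI _ t (flow_continuous w) ht).
    assert (o2 := little_o_linear Ainv _ lin (oI _ t (F_flow_continuous w) ht)).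
    assert (o3 := little_o_linear Ainv _ lin
      (proj2 (flow_evolves w) t ht)).
    destruct (proj1 (proj2 hAinv) (T t w)) as [dTw ATw].
    assert (o4 := generator_little_o S A hA _ dTw).
    eapply little_o_ext; [| exact (little_o_plus _ _ (little_o_plus _ _ o1 o2)
                                     (little_o_plus _ _ o3 o4))].
    intros h h0. cbv beta. rewrite ATw.
    rewrite <- (inverse_semigroup S hS A hA Ainv h (T t w) hAinv) by lra.
    unfold u, P, Q.
    rewrite !(lin_minus _ lin), !(lin_scal _ lin), !(lin_opp _ lin). vec. }
  assert (E := constant_of_right_derivative u cu du b hb).
  assert (E0 : u 0 = zero).
  { unfold u, P, Q.
    rewrite (flow_0 w).
    transitivity (minus (zero : H) (Ainv zero)).
    - f_equal; [exact (RInt_point 0 _) |]. f_equal.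
      transitivity (minus (minus w w) (zero : H)); [| vec].
      apply (f_equal (minus (minus w w))). exact (RInt_point 0 _).
    - rewrite (lin_zero _ lin). vec. }
  apply eq_of_norm_minus. change (norm (u b) <= 0). rewrite E, E0.
  right. exact norm_zero_H.
Qed.

Context (J : H -> H)
  (hJ : forall w, is_integral_0_infty (fun t => F (T t w)) (J w)).

Lemma lim_integral_flow w :
  is_lim_integral (fun t => T t w) (Ainv (minus w (J w))).
Proof.
  assert (lin := proj1 hAinv). destruct (lin_bound _ lin) as [c [hc Bc]].
  apply (is_lim_integral_intro _ (fun b =>
    Ainv (minus (minus w (T b w)) (RInt (fun t => F (T t w)) 0 b)))).
  - intros b hb. rewrite <- integral_flow by easy.
    apply RInt_correct. apply ex_RInt_half_line; [apply flow_continuous | lra].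
  - apply filterlim_p_infty_norm. intros e he.
    assert (pe : 0 < e / 2 / c) by (apply Rdiv_lt_0_compat; lra).
    destruct (lim_integral_elim _ _ (proj1 (hJ w)) _ pe) as [m1 [h1 B1]].
    assert (pw := norm_nonneg w).
    destruct (exp_decay_small alpha alpha_pos (e / 2 / c / (norm w + 1)))
      as [m2 [h2 B2]]; [apply Rdiv_lt_0_compat; lra |].
    exists (Rmax m1 m2). intros b hb.
    assert (l1 := Rmax_l m1 m2). assert (l2 := Rmax_r m1 m2).
    specialize (B1 b ltac:(lra)). specialize (B2 b ltac:(lra)).
    rewrite <- (lin_minus _ lin).
    apply Rle_trans with (1 := Bc _).
    apply Rle_trans with (c * (e / c)); [| right; field; lra].
    apply Rmult_le_compat_l; [lra |].
    set (I := RInt (fun t => F (T t w)) 0 b) in *.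
    apply Rle_trans with (norm (plus (T b w) (minus I (J w)))).
    { rewrite <- norm_opp_H. right. f_equal. vec. }
    apply Rle_trans with (1 := norm_plus_le _ _).
    replace (e / c) with (e / 2 / c + e / 2 / c) by (field; lra).
    apply Rplus_le_compat; [| exact B1].
    apply Rle_trans with (1 := flow_bound b w ltac:(lra)).
    apply Rle_trans with ((norm w + 1) * (e / 2 / c / (norm w + 1))).
    + apply Rmult_le_compat; try lra. left. apply exp_pos.
    + right. field. lra.
Qed.

Lemma integral_shift s w :
  0 <= s -> J (T s w) = minus (J w) (RInt (fun t => F (T t w)) 0 s).
Proof.
  intros hs. set (I := fun b => RInt (fun t => F (T t w)) 0 b).
  assert (X : forall a c, 0 <= a <= c -> ex_RInt (fun t => F (T t w)) a c).
  { intros a c hac. apply ex_RInt_half_line; [apply F_flow_continuous | easy]. }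
  assert (L : is_lim_integral (fun t => F (T t (T s w))) (minus (J w) (I s))).
  { apply (is_lim_integral_intro _ (fun b => minus (I (s + b)) (I s))).
    - intros b hb.
      assert (E : minus (I (s + b)) (I s)
                  = RInt (fun t => F (T t w)) s (s + b)).
      { unfold I. rewrite <- (RInt_Chasles _ 0 s (s + b));
          [vec | apply X | apply X]; lra. }
      rewrite E.
      assert (Y := RInt_correct _ _ _ (X s (s + b) ltac:(lra))).
      assert (W := is_RInt_comp_lin (fun t => F (T t w)) 1 s 0 b
        (RInt (fun t => F (T t w)) s (s + b))).
      rewrite Rmult_0_r, Rmult_1_l, Rplus_0_l, (Rplus_comm b) in W.
      eapply is_RInt_ext; [| exact (W Y)].
      intros t ht. rewrite Rmin_left, Rmax_right in ht by lra. cbv beta.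
      rewrite Rmult_1_l.
      rewrite flow_semigroup by lra. vec.
    - apply filterlim_p_infty_norm. intros e he.
      destruct (lim_integral_elim _ _ (proj1 (hJ w)) e he) as [m [hm B]].
      exists m. intros b hb. specialize (B (s + b) ltac:(lra)).
      apply Rle_trans with (2 := B). right. f_equal. unfold I. vec. }
  apply eq_of_norm_minus.
  apply Rle_trans with (0 / alpha); [| right; field; lra].
  apply (lim_integral_distance alpha _ _ _ _ 0 alpha_pos
    (proj1 (hJ (T s w))) L).
  intros t ht. rewrite norm_minus_diag. lra.
Qed.

Context (N : H -> H -> H)
  (hN : forall w h,
     is_integral_0_infty (fun t => dF (T t w) (dT t w h)) (N w h)).

Lemma N_combination w (a b : R) h k :
  N w (plus (scal a h) (scal b k)) = plus (scal a (N w h)) (scal b (N w k)).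
Proof.
  apply eq_of_norm_minus.
  apply Rle_trans with (0 / alpha); [| right; field; lra].
  apply (lim_integral_distance alpha _ _ _ _ 0 alpha_pos (proj1 (hN w _))
    (is_RInt_gen_plus _ _ _ _ (is_RInt_gen_scal _ a _ (proj1 (hN w h)))
      (is_RInt_gen_scal _ b _ (proj1 (hN w k))))).
  intros t ht. right.
  rewrite variation_combination by easy.
  assert (lin := differential_linear F dF hF (T t w)).
  rewrite (lin_plus _ lin), !(lin_scal _ lin), Rmult_0_l.
  transitivity (norm (zero : H)); [f_equal; vec | exact norm_zero_H].
Qed.

Lemma N_bound w : exists c, 0 <= c /\ forall h, norm (N w h) <= c * norm h.
Proof.
  assert (pw := norm_nonneg w).
  destruct (controlled_ball F dF hF hdF hdF0 (norm w) pw) as [L ctl].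
  assert (hD := ctl_D _ _ _ _ ctl).
  exists (L * norm w / alpha). split; [now apply Rle_mult_inv_pos |].
  intros h. replace (L * norm w / alpha * norm h)
    with (L * norm w * norm h / alpha) by (field; lra).
  apply (norm_lim_integral_le alpha alpha_pos _ _ _) with (2 := proj1 (hN w h)).
  intros t ht. apply (dF_flow_bound _ L (L * norm w) t w h ctl); try easy.
  intros s x hs hx. now apply flow_bound_ball.
Qed.

Lemma N_linear w : is_linear (N w).
Proof.
  split.
  - intros x y. assert (E := N_combination w 1 1 x y).
    etransitivity; [apply f_equal | etransitivity; [exact E |]]; vec.
  - intros k x. assert (E := N_combination w k 0 x x).
    etransitivity; [apply f_equal | etransitivity; [exact E |]]; vec.
  - destruct (N_bound w) as [c [hc B]]. exists (c + 1). split; [lra |].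
    intros x. assert (px := norm_nonneg x).
    apply Rle_trans with (c * norm x); [exact (B x) |].
    apply Rmult_le_compat_r; [exact px | lra].
Qed.

(** The integrand splits into the Taylor remainder of [F] along the two orbits
    and [dF (T t w)] applied to that of the flow. *)
Lemma J_taylor w :
  exists c, 0 <= c /\ forall v, norm (minus v w) <= 1 ->
    norm (minus (minus (J v) (J w)) (N w (minus v w)))
      <= c * norm (minus v w) * norm (minus v w).
Proof.
  assert (pw := norm_nonneg w).
  destruct (controlled_ball F dF hF hdF hdF0 (norm w + 1)) as [L ctl]; [lra |].
  assert (hL := ctl_L _ _ _ _ ctl). assert (hD := ctl_D _ _ _ _ ctl).
  set (D := L * (norm w + 1)) in *.
  assert (hDL : 0 <= D * (L / alpha)).
  { apply Rmult_le_pos; [easy | now apply Rle_mult_inv_pos]. }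
  exists ((L + D * (L / alpha)) / alpha). split.
  { apply Rle_mult_inv_pos; lra. }
  intros v hv. set (h := minus v w) in *. assert (ph := norm_nonneg h).
  assert (hh : 0 <= norm h * norm h) by now apply Rmult_le_pos.
  replace ((L + D * (L / alpha)) / alpha * norm h * norm h)
    with ((L + D * (L / alpha)) * (norm h * norm h) / alpha) by (field; lra).
  assert (nv : norm v <= norm w + 1).
  { assert (tri := norm_le_minus v w). fold h in tri. lra. }
  apply (lim_integral_distance alpha _ _ _ _ _ alpha_pos
    (is_RInt_gen_minus _ _ _ _ (proj1 (hJ v)) (proj1 (hJ w)))
    (proj1 (hN w h))).
  intros t ht.
  assert (bv : norm (T t v) <= norm w + 1) by now apply flow_bound_ball.
  assert (bw : norm (T t w) <= norm w + 1) by (apply flow_bound_ball; lra).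
  assert (lin := differential_linear F dF hF (T t w)).
  assert (pd := exp_decay_le alpha alpha_pos t ht).
  assert (D1 : norm (minus (minus (F (T t v)) (F (T t w)))
                 (dF (T t w) (minus (T t v) (T t w))))
               <= L * (norm h * norm h) * decay t).
  { apply Rle_trans with (1 := taylor F dF hF _ _ _ _ _ ctl bv bw).
    assert (cb := flow_contract t v w ht). fold h in cb.
    apply Rle_trans with (L * (norm h * decay t) * (norm h * decay t)).
    - assert (pn := norm_nonneg (minus (T t v) (T t w))).
      apply Rmult_le_compat; try easy.
      + now apply Rmult_le_pos.
      + now apply Rmult_le_compat_l.
    - replace (L * (norm h * decay t) * (norm h * decay t))
        with (L * (norm h * norm h) * (decay t ^ 2)) by ring.
      apply Rmult_le_compat_l; [now apply Rmult_le_pos |].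
      now apply decay_sq_le. }
  assert (D2 : norm (dF (T t w) (minus (minus (T t v) (T t w)) (dT t w h)))
               <= D * (L / alpha) * (norm h * norm h) * decay t).
  { apply Rle_trans with (1 := ctl_bound _ _ _ _ ctl _ _ bw).
    replace (D * (L / alpha) * (norm h * norm h) * decay t)
      with (D * (L * norm h * norm h / alpha * decay t)) by (field; lra).
    apply Rmult_le_compat_l; [easy |].
    apply (flow_taylor _ L D t v w ctl); [| easy].
    fold h. lra. }
  rewrite (lin_minus _ lin) in D2.
  apply Rle_trans with (norm (plus
    (minus (minus (F (T t v)) (F (T t w)))
           (dF (T t w) (minus (T t v) (T t w))))
    (minus (dF (T t w) (minus (T t v) (T t w))) (dF (T t w) (dT t w h))))).
  { right. f_equal. vec. }
  apply Rle_trans with (1 := norm_plus_le _ _).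
  replace ((L + D * (L / alpha)) * (norm h * norm h) * decay t)
    with (L * (norm h * norm h) * decay t
          + D * (L / alpha) * (norm h * norm h) * decay t) by ring.
  now apply Rplus_le_compat.
Qed.

Lemma N_lipschitz (B : H -> Prop) L D v w h :
  controlled dF B L D -> (forall s x, 0 <= s -> B x -> B (T s x)) ->
  B v -> B w ->
  norm (minus (N v h) (N w h))
    <= (L + D * (L / alpha)) / alpha * norm (minus v w) * norm h.
Proof.
  intros ctl inv hv hw.
  assert (hL := ctl_L _ _ _ _ ctl). assert (hD := ctl_D _ _ _ _ ctl).
  assert (pn := norm_nonneg (minus v w)). assert (ph := norm_nonneg h).
  assert (pp : 0 <= norm (minus v w) * norm h) by now apply Rmult_le_pos.
  replace ((L + D * (L / alpha)) / alpha * norm (minus v w) * norm h)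
    with ((L + D * (L / alpha)) * (norm (minus v w) * norm h) / alpha)
    by (field; lra).
  apply (lim_integral_distance alpha _ _ _ _ _ alpha_pos
    (proj1 (hN v h)) (proj1 (hN w h))).
  intros t ht.
  assert (lin := differential_linear F dF hF (T t w)).
  assert (D1 : norm (minus (dF (T t v) (dT t v h)) (dF (T t w) (dT t v h)))
               <= L * (norm (minus v w) * norm h) * decay t).
  { apply Rle_trans with (1 := ctl_lipschitz _ _ _ _ ctl (T t v) (T t w)
      (dT t v h) (inv t v ht hv) (inv t w ht hw)).
    apply Rle_trans with
      (L * (norm (minus v w) * decay t) * (norm h * decay t)).
    - apply Rmult_le_compat.
      + apply Rmult_le_pos; [easy | apply norm_nonneg].
      + apply norm_nonneg.
      + apply Rmult_le_compat_l; [easy | now apply flow_contract].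
      + now apply variation_bound.
    - replace (L * (norm (minus v w) * decay t) * (norm h * decay t))
        with (L * (norm (minus v w) * norm h) * (decay t ^ 2)) by ring.
      apply Rmult_le_compat_l; [now apply Rmult_le_pos |].
      now apply decay_sq_le. }
  assert (D2 : norm (dF (T t w) (minus (dT t v h) (dT t w h)))
               <= D * (L / alpha) * (norm (minus v w) * norm h) * decay t).
  { apply Rle_trans with (1 := ctl_bound _ _ _ _ ctl _ _ (inv t w ht hw)).
    replace (D * (L / alpha) * (norm (minus v w) * norm h) * decay t)
      with (D * (L * norm (minus v w) * norm h / alpha * decay t))
      by (field; lra).
    apply Rmult_le_compat_l; [easy |].
    now apply (variation_lipschitz B L D). }
  rewrite (lin_minus _ lin) in D2.
  apply Rle_trans with (1 := norm_minus_triangle _ (dF (T t w) (dT t v h)) _).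
  replace ((L + D * (L / alpha)) * (norm (minus v w) * norm h) * decay t)
    with (L * (norm (minus v w) * norm h) * decay t
          + D * (L / alpha) * (norm (minus v w) * norm h) * decay t) by ring.
  now apply Rplus_le_compat.
Qed.

(** * The map M *)

Lemma observed_inverse_linear : is_linear (fun y : H => K y).
Proof.
  destruct hi as [a [b [ha [hb B]]]]. destruct hAinv as [lin [inv _]].
  split.
  - intros x y. rewrite (lin_plus _ lin).
    apply op_plus; apply hCA; apply inv.
  - intros k x.
    rewrite (lin_scal _ lin k x : Ainv (scal k x) = scal k (Ainv x)).
    apply op_scal. apply hCA. apply inv.
  - destruct (lin_bound _ lin) as [c [hc Bc]].
    exists (a + b * c). split.
    { assert (0 < b * c) by now apply Rmult_lt_0_compat. lra. }
    intros x. destruct (inv x) as [dx Ex].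
    apply Rle_trans with (1 := B _ dx). rewrite Ex.
    assert (b * norm (Ainv x) <= b * (c * norm x))
      by (apply Rmult_le_compat_l; [lra | exact (Bc x)]).
    apply Rle_trans with (a * norm x + b * (c * norm x));
      [now apply Rplus_le_compat_l | right; ring].
Qed.

Local Notation Klin := observed_inverse_linear.

Definition observer w : Z := plus (opp (K w)) (K (J w)).

Definition d_observer w h : Z := plus (opp (K h)) (K (N w h)).

Lemma observer_taylor w :
  exists c, 0 <= c /\ forall v, norm (minus v w) <= 1 ->
    norm (minus (minus (observer v) (observer w)) (d_observer w (minus v w)))
      <= c * norm (minus v w) * norm (minus v w).
Proof.
  destruct (J_taylor w) as [c [hc B]].
  destruct (lin_bound _ Klin) as [k [hk Bk]].
  exists (k * c). split; [apply Rmult_le_pos; lra |].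
  intros v hv.
  apply Rle_trans with
    (norm (K (minus (minus (J v) (J w)) (N w (minus v w))))).
  { right. f_equal. unfold observer, d_observer.
    rewrite !(lin_minus _ Klin). vec. }
  apply Rle_trans with (1 := Bk _).
  rewrite !Rmult_assoc. apply Rmult_le_compat_l; [lra |].
  rewrite <- Rmult_assoc. now apply B.
Qed.

Lemma d_observer_linear w : is_linear (d_observer w).
Proof.
  assert (lin := N_linear w). split.
  - intros x y. unfold d_observer.
    rewrite (lin_plus _ lin), !(lin_plus _ Klin). vec.
  - intros k x. unfold d_observer.
    rewrite (lin_scal _ lin), !(lin_scal _ Klin). vec.
  - destruct (lin_bound _ lin) as [c [hc Bc]].
    destruct (lin_bound _ Klin) as [k [hk Bk]].
    exists (k + k * c). split.
    { assert (0 < k * c) by now apply Rmult_lt_0_compat. lra. }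
    intros x.
    apply Rle_trans with (norm (opp (K x)) + norm (K (N w x)));
      [apply norm_plus_le |].
    rewrite Rmult_plus_distr_r. apply Rplus_le_compat.
    { apply Rle_trans with (norm (K x)); [right; exact (norm_opp_H (K x)) |].
      exact (Bk x). }
    apply Rle_trans with (1 := Bk _). rewrite Rmult_assoc.
    apply Rmult_le_compat_l; [lra | apply Bc].
Qed.

Lemma observer_differentiable w :
  filterdiff observer (locally w) (d_observer w).
Proof.
  apply filterdiff_norm. split; [apply d_observer_linear |].
  destruct (observer_taylor w) as [c [hc B]].
  intros e he.
  assert (pe : 0 < e / (c + 1)) by (apply Rdiv_lt_0_compat; lra).
  exists (Rmin 1 (e / (c + 1))). split; [apply Rmin_glb_lt; lra |].
  intros v hv.
  assert (l1 := Rmin_l 1 (e / (c + 1))). assert (l2 := Rmin_r 1 (e / (c + 1))).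
  apply Rle_trans with (1 := B v (Rlt_le _ _ (Rlt_le_trans _ _ _ hv l1))).
  apply Rmult_le_compat_r; [apply norm_nonneg |].
  apply Rle_trans with ((c + 1) * (e / (c + 1))); [| right; field; lra].
  apply Rmult_le_compat; [easy | apply norm_nonneg | lra |].
  exact (Rlt_le _ _ (Rlt_le_trans _ _ _ hv l2)).
Qed.

Lemma d_observer_lipschitz (B : H -> Prop) L D :
  controlled dF B L D -> (forall s x, 0 <= s -> B x -> B (T s x)) ->
  op_lipschitz_on B d_observer.
Proof.
  intros ctl inv.
  assert (hL := ctl_L _ _ _ _ ctl). assert (hD := ctl_D _ _ _ _ ctl).
  destruct (lin_bound _ Klin) as [k [hk Bk]].
  assert (hc : 0 <= (L + D * (L / alpha)) / alpha).
  { apply Rle_mult_inv_pos; [| easy].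
    assert (0 <= D * (L / alpha))
      by (apply Rmult_le_pos; [| apply Rle_mult_inv_pos]; easy). lra. }
  exists (k * ((L + D * (L / alpha)) / alpha)).
  split; [apply Rmult_le_pos; lra |].
  intros v w hv hw.
  apply (op_norm_le (fun h => minus (d_observer v h) (d_observer w h))).
  { apply Rmult_le_pos; [apply Rmult_le_pos; lra | apply norm_nonneg]. }
  intros h.
  apply Rle_trans with (norm (K (minus (N v h) (N w h)))).
  { right. f_equal. unfold d_observer. rewrite (lin_minus _ Klin). vec. }
  apply Rle_trans with (1 := Bk _).
  rewrite !Rmult_assoc. apply Rmult_le_compat_l; [lra |].
  rewrite <- !Rmult_assoc. now apply (N_lipschitz B).
Qed.

Lemma d_observer_locally_lipschitz : op_locally_lipschitz d_observer.
Proof.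
  intros B [r hr].
  assert (r0 := Rmax_l 0 r). assert (r1 := Rmax_r 0 r).
  destruct (controlled_ball F dF hF hdF hdF0 (Rmax 0 r) r0) as [L ctl].
  destruct (d_observer_lipschitz _ _ _ ctl) as [c [hc Bc]].
  { intros s x hs hx. now apply flow_bound_ball. }
  exists c. split; [easy |]. intros x y hx hy.
  apply Bc; [exact (Rle_trans _ _ _ (hr x hx) r1)
            | exact (Rle_trans _ _ _ (hr y hy) r1)].
Qed.

Lemma observer_C1 : is_C1 observer d_observer.
Proof.
  split; [apply observer_differentiable |].
  intros w e. assert (he := cond_pos e).
  destruct (d_observer_locally_lipschitz (fun x => norm x <= norm w + 1))
    as [c [hc B]]; [now exists (norm w + 1) |].
  assert (pe : 0 < e / 2 / (c + 1)) by (apply Rdiv_lt_0_compat; lra).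
  assert (pm : 0 < Rmin 1 (e / 2 / (c + 1))) by (apply Rmin_glb_lt; lra).
  apply (locally_le_locally_norm w).
  exists (mkposreal _ pm). intros v hv.
  change (norm (minus v w) < Rmin 1 (e / 2 / (c + 1))) in hv.
  assert (l1 := Rmin_l 1 (e / 2 / (c + 1))).
  assert (l2 := Rmin_r 1 (e / 2 / (c + 1))).
  eapply Rbar_le_lt_trans; [apply B |].
  - apply Rle_trans with (1 := norm_le_minus v w).
    apply Rplus_le_compat_l. exact (Rlt_le _ _ (Rlt_le_trans _ _ _ hv l1)).
  - lra.
  - simpl. apply Rle_lt_trans with ((c + 1) * (e / 2 / (c + 1))).
    + apply Rmult_le_compat; [easy | apply norm_nonneg | lra |].
      exact (Rlt_le _ _ (Rlt_le_trans _ _ _ hv l2)).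
    + replace ((c + 1) * (e / 2 / (c + 1))) with (e / 2) by (field; lra). lra.
Qed.

Lemma observer_zero : observer zero = zero.
Proof.
  assert (J0 : J zero = zero).
  { apply eq_of_norm_minus.
    apply Rle_trans with (norm (J zero)); [right; f_equal; vec |].
    apply Rle_trans with (0 / alpha); [| right; field; lra].
    apply (norm_lim_integral_le alpha alpha_pos _ _ _)
      with (2 := proj1 (hJ zero)).
    intros t ht.
    rewrite flow_zero by easy.
    rewrite hF0. right. rewrite Rmult_0_l. exact norm_zero_H. }
  unfold observer. rewrite J0, (lin_zero _ Klin). vec.
Qed.

(** The value of [M] along an orbit is computed from the shifted integral, and
    its right derivative at [0] from the chain rule. *)
Lemma observer_equation w :
  dom A w -> plus (d_observer w (plus (A w) (F w))) (C w) = zero.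
Proof.
  intros hw. apply little_o_scal_zero.
  set (y := plus (A w) (F w)).
  assert (dlin := d_observer_linear w).
  assert (o1 : little_o (fun h : R => minus (minus (T h w) w) (scal h (opp y))))
    by now apply flow_right_derivative.
  pose (I := fun h : R => RInt (fun t => F (T t w)) 0 h).
  assert (o2 : little_o (fun h : R => minus (I h) (scal h (F w)))).
  { assert (o := little_o_RInt (fun t => F (T t w)) 0
      (fun h : R => RInt (fun t => F (T t w)) 0 (0 + h)) (F_flow_continuous w)
      (Rle_refl 0)).
    cbv beta in o. rewrite (flow_0 w) in o.
    eapply little_o_ext; [| apply o].
    - intros h hh. cbv beta. rewrite Rplus_0_l. reflexivity.
    - intros h hh. apply RInt_correct.
      apply ex_RInt_half_line; [apply F_flow_continuous | lra]. }
  assert (o3 : little_o (fun h : R =>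
    minus (minus (observer (T h w)) (observer w))
          (d_observer w (minus (T h w) w)))).
  { destruct (observer_taylor w) as [c [hc B]].
    intros e he.
    destruct (o1 1 Rlt_0_1) as [d [hd B1]].
    assert (py := norm_nonneg y).
    pose (n := 1 + norm y).
    assert (hn : 0 < n) by (unfold n; lra).
    assert (hcn : 0 < c * n * n + 1).
    { assert (0 <= c * n * n) by (repeat apply Rmult_le_pos; lra). lra. }
    exists (Rmin (Rmin d (/ n)) (e / (c * n * n + 1))). split.
    { repeat apply Rmin_glb_lt; [easy | now apply Rinv_0_lt_compat |].
      now apply Rdiv_lt_0_compat. }
    intros h hh.
    assert (l1 := Rmin_l (Rmin d (/ n)) (e / (c * n * n + 1))).
    assert (l2 := Rmin_r (Rmin d (/ n)) (e / (c * n * n + 1))).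
    assert (l3 := Rmin_l d (/ n)). assert (l4 := Rmin_r d (/ n)).
    specialize (B1 h ltac:(lra)). cbv beta in B1.
    assert (q : norm (minus (T h w) w) <= n * h).
    { apply Rle_trans with (1 := norm_le_minus _ (scal h (opp y))).
      replace (n * h) with (h * norm y + 1 * h) by (unfold n; ring).
      apply Rplus_le_compat; [| exact B1].
      expand_norm_scal. rewrite Rabs_pos_eq by lra.
      right. apply f_equal. exact (norm_opp_H y). }
    assert (q1 : n * h <= 1).
    { apply Rle_trans with (n * / n); [| right; field; lra].
      apply Rmult_le_compat_l; lra. }
    apply Rle_trans with (1 := B (T h w) (Rle_trans _ _ _ q q1)).
    assert (pq := norm_nonneg (minus (T h w) w)).
    apply Rle_trans with (c * (n * h) * (n * h)).
    - apply Rmult_le_compat; [now apply Rmult_le_pos | easy | | easy].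
      now apply Rmult_le_compat_l.
    - replace (c * (n * h) * (n * h)) with (c * n * n * h * h) by ring.
      apply Rmult_le_compat_r; [lra |].
      apply Rle_trans with ((c * n * n + 1) * (e / (c * n * n + 1))).
      + apply Rmult_le_compat; try lra. repeat apply Rmult_le_pos; lra.
      + right. field. lra. }
  assert (dlo := little_o_linear _ _ dlin o1).
  assert (Ko1 := little_o_linear _ _ Klin o1).
  assert (Ko2 := little_o_linear _ _ Klin o2).
  eapply little_o_ext; [| exact (little_o_plus _ _ (little_o_plus _ _ o3 dlo)
    (little_o_plus _ _ Ko1 Ko2))].
  intros h hh. cbv beta. unfold observer.
  rewrite integral_shift by lra.
  change (RInt (fun t => F (T t w)) 0 h) with (I h).
  assert (EC : C w = K (A w)).
  { now rewrite (proj2 (proj2 hAinv) w hw). }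
  rewrite EC. unfold y.
  rewrite !(lin_minus _ dlin), !(lin_scal _ dlin), !(lin_opp _ dlin),
    !(lin_minus _ Klin), !(lin_scal _ Klin), !(lin_opp _ Klin),
    !(lin_plus _ Klin). vec.
Qed.

End Observation.
End Variation.
End Flow.

Theorem theorem3p4
  (H Z : Hilbert)
  (A : linear_operator H H) (S : R -> H -> H)
  (hS : is_C0_semigroup S) (hA : opp_is_generator S A)
  (F : H -> H) (dF : H -> H -> H)
  (hF : is_C1 F dF) (hdF : op_locally_lipschitz dF)
  (hF0 : F zero = zero) (hdF0 : forall h, dF zero h = zero)
  (C : linear_operator H Z)
  (hCdense : dense (dom C)) (hCA : forall w, dom A w -> dom C w)
  (hi : exists a b : R, 0 < a /\ 0 < b /\
     forall w, dom A w -> norm (C w) <= a * norm (A w) + b * norm w)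
  (hii : exists alpha : R, 0 < alpha /\
     forall w h, dom A h ->
       inner (plus (A h) (dF w h)) h >= alpha * norm h ^ 2)
  (Ainv : H -> H) (hAinv : is_bounded_inverse A Ainv)
  (T : R -> H -> H)
  (hT : forall w, is_mild_solution S F w (fun t => T t w)) :
  exists (M : H -> Z) (dM : H -> H -> Z),
    is_C1 M dM /\
    op_locally_lipschitz dM /\
    M zero = zero /\
    (forall w, dom A w ->
       plus (dM w (plus (A w) (F w))) (C w) = zero) /\
    (forall w, exists l,
       is_lim_integral (fun t => T t w) l /\ dom C l /\ M w = opp (C l)) /\
    (forall w, exists J,
       is_integral_0_infty (fun t => F (T t w)) J /\
       M w = plus (opp (C (Ainv w))) (C (Ainv J))) /\
    (exists dT : R -> H -> H -> H,
       (forall t w, 0 <= t -> filterdiff (T t) (locally w) (dT t w)) /\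
       (forall w h, exists K,
          is_integral_0_infty (fun t => dF (T t w) (dT t w h)) K /\
          dM w h = plus (opp (C (Ainv h))) (C (Ainv K)))) /\
    (globally_lipschitz F -> op_globally_lipschitz dF ->
       op_globally_lipschitz dM).
Proof.
  destruct hii as [alpha [ha coe]].
  destruct (variation_family A S hS hA F dF hF hdF hF0 hdF0 alpha ha coe T hT)
    as [dT hdT].
  destruct (F_flow_integral A S hS hA F dF hF hdF hF0 hdF0 alpha ha coe T hT)
    as [J hJ].
  destruct (dF_flow_integral A S hS hA F dF hF hdF hF0 hdF0 alpha ha coe T hT
    dT hdT) as [N hN].
  exists (observer C Ainv J), (d_observer C Ainv N).
  assert (Klin := observed_inverse_linear A C hCA hi Ainv hAinv).
  split; [now apply (observer_C1 A S hS hA F dF hF hdF hF0 hdF0 alpha ha coe T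
    hT dT hdT C hCA hi Ainv hAinv J hJ N hN) |].
  split; [now apply (d_observer_locally_lipschitz A S hS hA F dF hF hdF hF0
    hdF0 alpha ha coe T hT dT hdT C hCA hi Ainv hAinv N hN) |].
  split; [now apply (observer_zero A S hS hA F dF hF hF0 alpha ha coe T hT
    C hCA hi Ainv hAinv J hJ) |].
  split; [now apply (observer_equation A S hS hA F dF hF hdF hF0 hdF0 alpha ha
    coe T hT dT hdT C hCA hi Ainv hAinv J hJ N hN) |].
  split.
  { intros w. exists (Ainv (minus w (J w))).
    split; [now apply (lim_integral_flow A S hS hA F dF hF hdF hF0 hdF0 alpha ha
      coe T hT Ainv hAinv J hJ) |].
    split; [apply hCA; apply hAinv |].
    rewrite (lin_minus _ Klin). unfold observer. vec. }
  split.
  { intros w. exists (J w). split; [apply hJ | reflexivity]. }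
  split.
  { exists dT. split.
    - intros t w ht. now apply (flow_differentiable A S hS hA F dF hF hdF hF0
        hdF0 alpha ha coe T hT dT hdT).
    - intros w h. exists (N w h). split; [apply hN | reflexivity]. }
  intros lipF lipdF.
  destruct (controlled_global F dF hF lipF lipdF) as [L [D ctl]].
  now apply (d_observer_lipschitz A S hS hA F dF hF hdF hF0 hdF0 alpha ha coe T
    hT dT hdT C hCA hi Ainv hAinv N hN (fun _ => True) L D).
Qed.
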